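(* Let $\alpha\in(1,2)$, $m>0$ and $X\sim\mathcal{S}(\alpha,0,m,m)$. Let $Y_1,Y_2,\ldots,Y_n$ be i.i.d. random variables with $\mathbb{E}Y_i=0$ and $\mathbb{E}|Y_i|<\infty$. Put $Z_i=n^{-1/\alpha}Y_i$ and $S_n=Z_1+Z_2+\cdots+Z_n$. Then, for every $N>0$, $$d_{W_2}(S_n,X)\le\frac12\sum_{i=1}^{n}\int_{-N}^{N}\left|\frac{K_{\nu_\alpha}(t,N)}{n}-K_i(t,N)\right|dt+R_{n,N},$$ where $$R_{n,N}=2\left(\int_{|u|>N}|u|\,\nu_\alpha(du)+\sum_{i=1}^{n}\mathbb{E}\left[|Z_i|\mathbf{1}_{\{|Z_i|>N\}}\right]\right)+\frac{C_{\alpha,m}}{n}\sum_{i=1}^{n}\mathbb{E}|Z_i|^{2-\alpha}$$ and $C_{\alpha,m}$ is a positive constant depending only on $\alpha$ and $m$.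
   Context: $X\sim\mathcal{S}(\alpha,0,m,m)$ means that $\mathbb{E}(e^{izX})=\exp\left(\int_{\mathbb{R}}\left(e^{izu}-1-izu\mathbf{1}_{\{|u|\le1\}}(u)\right)\nu_\alpha(du)\right)$, $z\in\mathbb{R}$, with $\nu_\alpha(du)=m|u|^{-1-\alpha}du$ on $\mathbb{R}\setminus\{0\}$. For $N>0$ and $t\in\mathbb{R}$, $$K_{\nu_\alpha}(t,N)=\mathbf{1}_{[0,N]}(t)\int_t^Nu\,\nu_\alpha(du)+\mathbf{1}_{[-N,0]}(t)\int_{-N}^t(-u)\,\nu_\alpha(du),$$ $$K_i(t,N)=\mathbb{E}\left(Z_i\mathbf{1}_{\{0\le t\le Z_i\le N\}}-Z_i\mathbf{1}_{\{-N\le Z_i\le t\le0\}}\right).$$ The Wasserstein-type distance is $d_{W_2}(Y,Z)=\sup_{h\in\mathcal{H}_2}|\mathbb{E}h(Y)-\mathbb{E}h(Z)|$, where $\mathcal{H}_2$ is the set of twice continuously differentiable $h:\mathbb{R}\to\mathbb{R}$ with $\|h^{(k)}\|\le1$ for $k=0,1,2$, $\|f\|=\sup_{x\in\mathbb{R}}|f(x)|$. *)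

(* Defs.v *)
From HB Require Import structures.
From mathcomp Require Import all_boot all_order all_algebra.
From mathcomp Require Import all_classical all_reals all_analysis.
From mathcomp Require Import measurable_realfun complex.

Set Implicit Arguments.
Unset Strict Implicit.
Unset Printing Implicit Defensive.

Import Order.TTheory GRing.Theory Num.Theory.
Import numFieldNormedType.Exports.

Local Open Scope classical_set_scope.
Local Open Scope ring_scope.

(* The value at 0 is irrelevant, since [levy_measure] does not charge 0. *)
Definition levy_density {R : realType} (alpha : R) (m : {posnum R}) (u : R) : R :=
  m%:num * `|u| `^ (- 1 - alpha).

Definition levy_measure {R : realType} (alpha : R) (m : {posnum R})
    (A : set R) : \bar R :=
  (\int[lebesgue_measure]_(u in A `\ 0%R) (levy_density alpha m u)%:E)%E.

Lemma measurable_levy_density {R : realType} (alpha : R) (m : {posnum R}) :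
  measurable_fun [set: R] (levy_density alpha m).
Proof.
apply: (@measurable_comp _ _ _ _ _ _ setT ( *%R m%:num)) => //.
apply: (@measurableT_comp _ _ _ _ _ _ (@powR R ^~ (- 1 - alpha))) => //.
Qed.

Lemma levy_density_ge0 {R : realType} (alpha : R) (m : {posnum R}) (u : R) :
  0 <= levy_density alpha m u.
Proof. by rewrite mulr_ge0// powR_ge0. Qed.

Section levy_measure.
Context {R : realType} (alpha : R) (m : {posnum R}).
Local Notation nu := (levy_measure alpha m).

Let nu0 : nu set0 = 0%E.
Proof. by rewrite /levy_measure set0D integral_set0. Qed.

Let nu_ge0 A : (0 <= nu A)%E.
Proof. by apply: integral_ge0 => u _; rewrite lee_fin levy_density_ge0. Qed.

Let nu_sigma_additive : semi_sigma_additive nu.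
Proof.
move=> F mF tF mUF; rewrite /levy_measure setD_bigcupl.
rewrite ge0_integral_bigcup//=.
- apply: is_cvg_ereal_nneg_natsum_cond => k _ _; exact: nu_ge0.
- by move=> k; apply: measurableD; [exact: mF|exact: measurable_set1].
- apply/measurable_EFinP; apply: measurable_funTS.
  exact: measurable_levy_density.
- by move=> u _; rewrite lee_fin levy_density_ge0.
- move=> i j _ _ [u [[Fiu _] [Fju _]]]; apply: tF => //.
  by exists u.
Qed.

HB.instance Definition _ := isMeasure.Build _ _ _ nu nu0 nu_ge0
  nu_sigma_additive.

End levy_measure.

Definition cexp {R : realType} (z : R[i]) : R[i] :=
  (expR (complex.Re z) * cos (complex.Im z) +i* (expR (complex.Re z) * sin (complex.Im z)))%C.

Definition cintegral {d} {T : measurableType d} {R : realType}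
    (mu : {measure set T -> \bar R}) (f : T -> R[i]) : R[i] :=
  (Rintegral mu setT (fun x => complex.Re (f x)) +i*
   Rintegral mu setT (fun x => complex.Im (f x)))%C.

Definition characteristic_function {d} {T : measurableType d} {R : realType}
    (P : probability T R) (X : T -> R) (z : R) : R[i] :=
  cintegral P (fun w => cexp ('i%C * (z * X w)%:C%C)).

(* X ~ S(alpha, 0, m, m) *)
Definition symmetric_stable {d} {T : measurableType d} {R : realType}
    (alpha : R) (m : {posnum R}) (P : probability T R) (X : T -> R) : Prop :=
  forall z : R,
    characteristic_function P X z =
    cexp (cintegral (levy_measure alpha m) (fun u : R =>
      cexp ('i%C * (z * u)%:C%C) - 1
        - 'i%C * (z * u * (`|u| <= 1)%R%:R)%:C%C)).

(* Extended-real valued: K_nu(0, N) = +oo when alpha > 1.  Outside the support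
   of an indicator the corresponding product is 0, as 0 * x = 0 for every
   x : \bar R. *)
Definition K_nu {R : realType} (alpha : R) (m : {posnum R}) (t N : R) : \bar R :=
  ((0 <= t <= N)%R%:R%:E * \int[levy_measure alpha m]_(u in `[t, N]) u%:E
   + (- N <= t <= 0)%R%:R%:E
     * \int[levy_measure alpha m]_(u in `[(- N)%R, t]) (- u)%:E)%E.

Definition K_rv {d} {T : measurableType d} {R : realType}
    (P : probability T R) (Z : T -> R) (t N : R) : \bar R :=
  ('E_P[fun w => (Z w * [&& 0 <= t, t <= Z w & Z w <= N]%:R
                - Z w * [&& - N <= Z w, Z w <= t & t <= 0]%:R)%R])%E.

Definition sup_norm {R : realType} (f : R -> R) : \bar R :=
  ereal_sup [set `|f x|%:E | x in [set: R]].

Definition C2 {R : realType} (h : R -> R) : Prop :=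
  [/\ forall x, derivable h x 1, forall x, derivable h^`()%classic x 1
    & continuous h^`(2)%classic].

Definition H2 {R : realType} : set (R -> R) :=
  [set h | C2 h /\ forall k, (k <= 2)%N -> (sup_norm h^`(k)%classic <= 1)%E].

Definition dW2 {d d'} {T : measurableType d} {T' : measurableType d'}
    {R : realType} (P : probability T R) (Y : T -> R)
    (Q : probability T' R) (Z : T' -> R) : \bar R :=
  ereal_sup [set `| 'E_P[h \o Y] - 'E_Q[h \o Z]|%E | h in H2].

Definition mutually_independent {d} {T : measurableType d} {R : realType}
    (P : probability T R) (I : finType) (Y : I -> T -> R) : Prop :=
  forall (J : {set I}) (B : I -> set R), (forall i, measurable (B i)) ->
    P (\bigcap_(i in [set` J]) (Y i @^-1` B i)) =
    (\prod_(i in J) P (Y i @^-1` B i))%E.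

Definition identically_distributed {d} {T : measurableType d} {R : realType}
    (P : probability T R) (I : finType) (Y : I -> T -> R) : Prop :=
  forall (i j : I) (B : set R), measurable B ->
    P (Y i @^-1` B) = P (Y j @^-1` B).

(* Main.v *)
Require Import Defs.
From HB Require Import structures.
From mathcomp Require Import all_boot all_order all_algebra.
From mathcomp Require Import all_classical all_reals all_analysis.
From mathcomp Require Import measurable_realfun complex.
From mathcomp Require Import ring lra.

Set Implicit Arguments.
Unset Strict Implicit.
Unset Printing Implicit Defensive.

Import Order.TTheory GRing.Theory Num.Theory.
Import numFieldNormedType.Exports.

Local Open Scope classical_set_scope.
Local Open Scope ring_scope.

(** The proof is Stein's method run along an interpolation, for test functions
that are finite sums of cosines.

Let nu be the Levy measure, psi(z) the integral of 1 - cos (z u) against nu,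
and S = Z_1 + ... + Z_n.  The characteristic function of X is exp(- psi), and
psi(z) = |z|^alpha psi(1) by scaling.  For a sum of cosines h put
sigma(s) = (1 - s^alpha)^(1/alpha) and g_s(x) = E h(s x + sigma(s) X).  Then
g_1 = h and g_0 is the constant E h(X), so that E h(S) - E h(X) is the increment
of s |-> E g_s(S) over [0, 1].  Averaging a cosine over X only multiplies its
amplitude by a value of exp(- psi) ([stable_smoothing]); hence g_s is again an
explicit sum of cosines, and differentiating it in s gives
[[
  d/ds g_s(x) = x q_s(x) - int u (q_s(x + u) - q_s(x)) nu(du),
]]
where q_s(x) = E h'(s x + sigma(s) X) ([is_derive_interpolant]).  The identity
behind this is z int u sin(z u) nu(du) = alpha psi(z) ([mul_levy_sin]).  Being an
average of values of h', q_s satisfies |q_s| <= sup |h'| and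
|q_s'| <= s sup |h''| ([damping_bound]); integrating the factor s over [0, 1]
produces the factor 1/2 in front of the distance between the kernels.

For fixed q the quantity E[S q(S)] - E int u (q(S + u) - q(S)) nu(du) is
estimated summand by summand ([stein_pair], [stein_sum]).  The variable
V_i = S - Z_i is independent of Z_i and E Z_i = 0, so
E[Z_i q(S)] = E[Z_i (q(V_i + Z_i) - q(V_i))].  Restricted to |Z_i| <= N this
equals int K_i(t, N) E q'(V_i + t) dt by Fubini, and in the same way the part
|u| <= N of the integral against nu, taken at V_i, is
int K_nu(t, N) E q'(V_i + t) dt ([integral_kernel]); the two differ by at most
sup |q'| times the distance between the kernels ([kernel_comparison]).  Jumps
larger than N cost 2 sup |q| times their first absolute moment.  Finally,
replacing S by V_i in the integral against nu changes its integrand by at most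
2 sup |q'| |u| min(|Z_i|, |u|), whose integral against nu is by scaling a
constant times |Z_i|^(2 - alpha) ([generator_holder]).

A general test function is reached through h (L sin (x / L)) with L large: on
[- L, L] the function h is close to a polynomial together with two derivatives,
and a polynomial in sin (x / L) is a sum of cosines ([trig_approx_H2]).
Dominated convergence then transfers the bound ([H2_comparison]). *)

(** * Finite sums of cosines *)
Section trig_sums.
Context {R : realType}.
Implicit Types (l : seq (R * R * R)) (w : R * R * R) (x s : R).

(** Lists of triples (amplitude, frequency, phase): with a free phase the sums
are closed under differentiation, dilation and multiplication by a sine. *)
Definition trig l x : R := \sum_(w <- l) w.1.1 * cos (w.1.2 * x + w.2).

Definition mult (g : R -> R) l : seq (R * R * R) :=
  [seq (w.1.1 * g w.1.2, w.1.2, w.2) | w <- l].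

(** A quarter turn of all phases: cosines become minus sines. *)
Definition quarter l : seq (R * R * R) :=
  [seq (w.1.1, w.1.2, w.2 + pi / 2) | w <- l].

Definition dilate s l : seq (R * R * R) :=
  [seq (w.1.1, w.1.2 * s, w.2) | w <- l].

Definition dtrig l := mult id (quarter l).

Lemma trigE (g : R -> R) l x :
  trig (mult g l) x = \sum_(w <- l) w.1.1 * g w.1.2 * cos (w.1.2 * x + w.2).
Proof. by rewrite /trig big_map. Qed.

Lemma trig_mult_quarter (g : R -> R) l x : trig (mult g (quarter l)) x =
  - \sum_(w <- l) w.1.1 * g w.1.2 * sin (w.1.2 * x + w.2).
Proof.
rewrite trigE big_map -sumrN; apply: eq_bigr => w _ /=.
by rewrite addrA cosDpihalf mulrN.
Qed.

Lemma trig_dilate s l x : trig (dilate s l) x = trig l (s * x).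
Proof.
by rewrite /trig big_map; apply: eq_bigr => w _ /=; rewrite mulrA.
Qed.

Lemma dtrig_dilate s l x : trig (dtrig (dilate s l)) x = s * trig (dtrig l) (s * x).
Proof.
rewrite !trig_mult_quarter big_map mulrN mulr_sumr; congr (- _).
by apply: eq_bigr => w _ /=; rewrite -(mulrA w.1.2 s x); ring.
Qed.

Lemma dtrig_mult (g : R -> R) l : dtrig (mult g l) = mult g (dtrig l).
Proof.
rewrite /dtrig /mult /quarter -!map_comp; apply: eq_map => w /=.
by congr (_, _, _); ring.
Qed.

Lemma is_derive_trig l x : is_derive x 1 (trig l) (trig (dtrig l) x).
Proof.
rewrite trig_mult_quarter /trig -sumrN.
elim: l => [|w l ih].
  rewrite big_nil; under eq_fun do rewrite big_nil.
  exact: is_derive_cst.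
rewrite big_cons; under eq_fun do rewrite big_cons.
have h : is_derive x 1 (fun x => w.1.2 * x + w.2) w.1.2.
  by apply: is_derive_eq; rewrite /GRing.scale/=; ring.
apply: is_deriveD.
have h2 := @is_derive1_comp _ cos (fun x => w.1.2 * x + w.2) x _ _
  (is_derive_cos (w.1.2 * x + w.2)) h.
have h3 := is_deriveZ w.1.1 h2.
by apply: is_derive_eq; rewrite /GRing.scale/=; ring.
Qed.

Lemma trig_le l x : `|trig l x| <= \sum_(w <- l) `|w.1.1|.
Proof.
rewrite (le_trans (ler_norm_sum _ _ _))//; apply: ler_sum => w _.
by rewrite normrM ler_piMr// cos_max.
Qed.

Lemma continuous_trig l : continuous (trig l).
Proof.
move=> x; apply: differentiable_continuous; apply/derivable1_diffP.
by have /@ex_derive := is_derive_trig l x.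
Qed.

Lemma measurable_trig l : measurable_fun setT (trig l).
Proof. exact: continuous_measurable_fun (@continuous_trig l). Qed.

(** By Horner's scheme it is enough to multiply by L sin (x / L), and
2 cos a sin b = sin (a + b) - sin (a - b) turns that into a shift of
frequencies by 1 / L. *)
Lemma trig_poly_sin (p : {poly R}) (L : R) : L != 0 ->
  exists l, forall x, trig l x = p.[L * sin (x / L)].
Proof.
move=> L0; elim/poly_ind: p => [|p c [l ih]].
  by exists [::] => x; rewrite /trig big_nil horner0.
exists ((c, 0, 0) :: [seq (w.1.1 * L / 2, w.1.2 + L^-1, w.2 - pi / 2) | w <- l]
     ++ [seq (- (w.1.1 * L / 2), w.1.2 - L^-1, w.2 - pi / 2) | w <- l]) => x.
rewrite hornerMXaddC -ih /trig big_cons big_cat/= mul0r add0r cos0 mulr1.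
rewrite !big_map/= [LHS]addrC; congr (_ + _).
rewrite mulr_suml -big_split/=; apply: eq_bigr => w _.
rewrite !addrA !cosBpihalf.
have -> : (w.1.2 + L^-1) * x + w.2 = (w.1.2 * x + w.2) + x / L by ring.
have -> : (w.1.2 - L^-1) * x + w.2 = (w.1.2 * x + w.2) + - (x / L) by ring.
by rewrite !sinD cosN sinN; field.
Qed.

End trig_sums.

(** * Bernstein approximation *)
Section weierstrass.
Context {R : realType}.
Implicit Types (g h : nat -> R) (t x : R).

(** The expectation of g at a binomial (n, t) variable, computed by conditioning
on the first trial. *)
Fixpoint bern (n : nat) g t : R :=
  if n is n'.+1 then t * bern n' (g \o succn) t + (1 - t) * bern n' g t
  else g 0%N.

Lemma horner_bern n g (u : {poly R}) :
  exists p : {poly R}, forall x, p.[x] = bern n g u.[x].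
Proof.
elim: n g => [|n ih] g /=; first by exists (g 0%N)%:P => x; rewrite hornerC.
have [p pE] := ih g; have [q qE] := ih (g \o succn).
by exists (u * q + (1 - u) * p) => x; rewrite !hornerE pE qE.
Qed.

Lemma le_bern n g h t : 0 <= t <= 1 ->
  (forall k, (k <= n)%N -> g k <= h k) -> bern n g t <= bern n h t.
Proof.
move=> /andP[t0 t1]; elim: n g h => [|n ih] g h gh /=; first exact: gh.
apply: lerD; apply: ler_wpM2l; rewrite ?subr_ge0//; apply: ih => k kn /=.
  exact: gh.
by apply: gh; exact: leqW.
Qed.

(** The second moment of a binomial variable about an arbitrary point c; keeping
c free is what makes the induction on n go through. *)
Lemma bern_sqr n (a b c : R) t :
  bern n (fun k => a + b * (k%:R - c) ^+ 2) t =
  a + b * (n%:R * t * (1 - t) + (n%:R * t - c) ^+ 2).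
Proof.
elim: n c => [|n ih] c /=; first by ring.
rewrite ih (_ : _ \o _ = fun k : nat => a + b * (k%:R - (c - 1)) ^+ 2); last first.
  by apply/funext => k /=; rewrite -natr1; congr (_ + _ * _ ^+ 2); ring.
by rewrite ih -natr1; ring.
Qed.

Lemma unif_cont_segment (f : R -> R) (a b e : R) : continuous f -> 0 < e ->
  exists2 d : R, 0 < d & forall x, a <= x <= b ->
    forall y, `|y - x| < d -> `|f y - f x| < e.
Proof.
move=> cf e0.
have /compact_near_coveringP nc := @segment_compact R a b.
have [] := nc R (0 : R)^'+ (fun d x => forall y, `|y - x| < d -> `|f y - f x| < e).
- move=> x _.
  have e20 : 0 < e / 2 by rewrite divr_gt0.
  have /cvgrPdist_lt/(_ _ e20) [/= r r0 fr] := cf x.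
  exists ([set y | `|x - y| < r / 2], [set d : R | d < r / 2]) => /=.
    split; first by exists (r / 2) => //=; rewrite divr_gt0.
    apply: nbhs_right_lt; by rewrite divr_gt0.
  move=> [z d] /= [xz dr] y yz.
  have h1 : `|f x - f z| < e / 2 by apply: fr => /=; lra.
  have h2 : `|f x - f y| < e / 2.
    apply: fr => /=.
    rewrite (_ : x - y = (x - z) - (y - z)); last ring.
    by rewrite (le_lt_trans (ler_normB _ _))//; lra.
  rewrite (_ : f y - f z = (f x - f z) - (f x - f y)); last ring.
  by rewrite (le_lt_trans (ler_normB _ _))//; lra.
- move=> r r0 Hr; exists (r / 2); first by rewrite divr_gt0.
  move=> x xab; apply: (Hr (r / 2) _ _ x) => //=.
  + by rewrite sub0r normrN gtr0_norm ?divr_gt0//; move: r0 => /=; lra.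
  + by rewrite divr_gt0.
Qed.

(** Where the node lies within d of x, f varies by less than e / 2; elsewhere
the square of the distance divided by d bounds the indicator, and
[bern_sqr] shows that its mean is of order 1 / n. *)
Lemma weierstrass (f : R -> R) (M L e : R) : continuous f ->
  (forall x, `|f x| <= M) -> 0 < L -> 0 < e ->
  exists p : {poly R}, forall x, - L <= x <= L -> `|p.[x] - f x| <= e.
Proof.
move=> cf fM L0 e0.
have e20 : 0 < e / 2 by rewrite divr_gt0.
have [d d0 fd] := unif_cont_segment (- L) L cf e20.
have M0 : 0 <= M by rewrite (le_trans _ (fM 0)).
pose K := 2 * M * (2 * L / d) ^+ 2.
have K0 : 0 <= K by rewrite /K mulr_ge0 ?sqr_ge0// mulr_ge0.
pose n := (Num.truncn (K / e)).+1.
have nK : K / e < n%:R by exact: truncnS_gt.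
have n0 : 0 < n%:R :> R by rewrite ltr0n.
(* [u] maps [- L, L] onto [0, 1]; [nd] is its inverse at k / n *)
pose u : {poly R} := (2 * L)^-1 *: 'X + (2^-1)%:P.
pose nd (k : nat) : R := 2 * L * (k%:R / n%:R) - L.
have [p pE] := horner_bern n (f \o nd) u.
exists p => x xL; rewrite pE.
set t := u.[x].
have xE : x = 2 * L * t - L.
  by rewrite /t /u !hornerE; field; rewrite gt_eqF.
have t01 : 0 <= t <= 1.
  move: xL; rewrite xE => /andP[h1 h2]; apply/andP; split.
    by rewrite -(pmulr_rge0 _ (_ : 0 < 2 * L)) ?mulr_gt0//; lra.
  by rewrite -(ler_pM2l (_ : 0 < 2 * L)) ?mulr_gt0//; lra.
have key k : `|f (nd k) - f x| <= e / 2 + K / n%:R ^+ 2 * (k%:R - n%:R * t) ^+ 2.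
  have ndx : nd k - x = 2 * L / n%:R * (k%:R - n%:R * t).
    by rewrite {1}xE /nd; field; rewrite gt_eqF.
  have [lt|ge] := ltP `|nd k - x| d.
    rewrite (le_trans (ltW (fd _ xL _ lt)))// lerDl mulr_ge0 ?sqr_ge0//.
    by rewrite divr_ge0// sqr_ge0.
  rewrite (le_trans (ler_normB _ _))// (@le_trans _ _ (2 * M))//.
    by have := fM (nd k); have := fM x; lra.
  have -> : K / n%:R ^+ 2 * (k%:R - n%:R * t) ^+ 2 = 2 * M * ((nd k - x) / d) ^+ 2.
    by rewrite ndx /K; field; rewrite !gt_eqF.
  rewrite (@le_trans _ _ (2 * M * ((nd k - x) / d) ^+ 2))//; last first.
    by rewrite lerDr ltW.
  rewrite ler_peMr ?mulr_ge0// -real_normK ?num_real// expr_ge1//.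
  by rewrite normrM normfV (gtr0_norm d0) ler_pdivlMr// mul1r.
have bound : e / 2 + K / n%:R ^+ 2 * (n%:R * t * (1 - t) + (n%:R * t - n%:R * t) ^+ 2) <= e.
  have -> : K / n%:R ^+ 2 * (n%:R * t * (1 - t) + (n%:R * t - n%:R * t) ^+ 2) =
     K / n%:R * (t * (1 - t)) by field; rewrite gt_eqF.
  have h1 : t * (1 - t) <= 2^-1 by have := sqr_ge0 (t - 2^-1); nra.
  have h2 : K / n%:R <= e by rewrite ler_pdivrMr// mulrC -ler_pdivrMr// ltW.
  have h3 : K / n%:R * (t * (1 - t)) <= e * 2^-1.
    apply: ler_pM => //; first by rewrite divr_ge0// ltW.
    by move: t01 => /andP[? ?]; rewrite mulr_ge0// subr_ge0.
  by lra.
rewrite ler_distl; apply/andP; split.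
  have : bern n (fun k => (f x - e / 2) + (- (K / n%:R ^+ 2)) * (k%:R - n%:R * t) ^+ 2) t
     <= bern n (f \o nd) t.
    apply: le_bern => // k _ /=; have := key k; rewrite ler_distl => /andP[+ _].
    by rewrite mulNr; lra.
  rewrite bern_sqr; move: bound; rewrite mulNr; lra.
have : bern n (f \o nd) t <=
    bern n (fun k => (f x + e / 2) + (K / n%:R ^+ 2) * (k%:R - n%:R * t) ^+ 2) t.
  apply: le_bern => // k _ /=; have := key k; rewrite ler_distl => /andP[_].
  by lra.
rewrite bern_sqr; move: bound; lra.
Qed.

End weierstrass.

(** * Approximation of test functions *)
Section approximation.
Context {R : realType}.
Implicit Types (f h : R -> R) (x : R).

Lemma mean_value_le f (df : R -> R) (u v c : R) :
  (forall x, is_derive x 1 f (df x)) ->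
  (forall x, u <= x <= v -> `|df x| <= c) ->
  forall a b, u <= a <= v -> u <= b <= v -> `|f b - f a| <= c * `|b - a|.
Proof.
move=> fdf dfc.
have cf : continuous f.
  move=> x; apply: differentiable_continuous; apply/derivable1_diffP.
  by have /@ex_derive := fdf x.
suff H a b : u <= a <= v -> u <= b <= v -> a <= b -> `|f b - f a| <= c * `|b - a|.
  move=> a b ha hb; have [ab|/ltW ba] := leP a b; first exact: H.
  by rewrite distrC (distrC b); exact: H.
move=> /andP[ua av] /andP[ub bv] ab.
have [x xab ->] := MVT_segment ab (fun x _ => fdf x) (continuous_subspaceT cf).
move: xab; rewrite in_itv/= => /andP[ax xb].
by rewrite normrM ler_wpM2r// dfc// (le_trans ua ax) (le_trans xb bv).
Qed.

Lemma poly_antiderivative (q : {poly R}) (c : R) :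
  exists2 p : {poly R}, p^`() = q & p.[0] = c.
Proof.
exists (\poly_(i < (size q).+1) (if i is j.+1 then q`_j / j.+1%:R else c)).
  apply/polyP => i; rewrite coef_deriv coef_poly ltnS.
  case: ltnP => [_|qi].
    by rewrite -[LHS]mulr_natr divfK// pnatr_eq0.
  by rewrite mul0rn nth_default.
by rewrite horner_coef0 coef_poly.
Qed.

Lemma H2_derive h : H2 h ->
  [/\ forall x, is_derive x 1 h (h^`()%classic x),
      forall x, is_derive x 1 h^`()%classic (h^`(2)%classic x),
      continuous h^`(2)%classic &
      forall k x, (k <= 2)%N -> `|h^`(k)%classic x| <= 1].
Proof.
move=> [[dh dh1 ch2] hle]; split.
- by move=> x; apply: DeriveDef; [exact: dh|rewrite derive1E].
- by move=> x; apply: DeriveDef; [exact: dh1|rewrite derive1nS -derive1E].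
- exact: ch2.
- move=> k x k2; rewrite -lee_fin (le_trans _ (hle k k2))//.
  by apply: ereal_sup_ubound; exists x.
Qed.

(** Approximate the second derivative and integrate twice from 0, matching h
and h' there: each integration costs a factor L. *)
Lemma poly_approx_H2 h (L e : R) : H2 h -> 0 < L -> 0 < e ->
  exists p : {poly R}, forall x, - L <= x <= L ->
    [/\ `|p.[x] - h x| <= e, `|p^`().[x] - h^`()%classic x| <= e &
        `|p^`()^`().[x] - h^`(2)%classic x| <= e].
Proof.
move=> /H2_derive[dh dh1 ch2 hle] L0 e0.
(* the three errors are e', e' L and e' L^2 *)
pose e' := e / (1 + L + L ^+ 2).
have D0 : 0 < 1 + L + L ^+ 2 by rewrite !addr_gt0 ?exprn_gt0.
have e'0 : 0 < e' by rewrite divr_gt0.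
have [q qE] := weierstrass ch2 (hle 2%N ^~ isT) L0 e'0.
have [p1 p1E p10] := poly_antiderivative q (h^`()%classic 0).
have [p pE p0] := poly_antiderivative p1 (h 0).
have z0 : - L <= 0 <= L by rewrite oppr_le0 ltW//= ltW.
have eE : e = e' + e' * L + e' * L * L.
  by rewrite /e'; field; rewrite gt_eqF.
have h1 x : - L <= x <= L -> `|p1.[x] - h^`()%classic x| <= e' * L.
  move=> xL.
  have := @mean_value_le (fun x => p1.[x] - h^`()%classic x)
     (fun x => p1^`().[x] - h^`(2)%classic x) (- L) L e' _ _ 0 x z0 xL.
  rewrite p10 subrr !subr0 => H.
  apply: le_trans (H (fun y => is_deriveB (is_derive_poly p1 y) (dh1 y)) _) _.
  - by move=> y yL; rewrite p1E qE.
  - by rewrite ler_wpM2l// ?ler_norml// ltW.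
have h0 x : - L <= x <= L -> `|p.[x] - h x| <= e' * L * L.
  move=> xL.
  have := @mean_value_le (fun x => p.[x] - h x)
     (fun x => p^`().[x] - h^`()%classic x) (- L) L (e' * L) _ _ 0 x z0 xL.
  rewrite p0 subrr !subr0 => H.
  apply: le_trans (H (fun y => is_deriveB (is_derive_poly p y) (dh y)) _) _.
  - by move=> y yL; rewrite pE h1.
  - by rewrite ler_wpM2l// ?ler_norml// mulr_ge0// ltW.
clearbody e'.
have e'L : 0 <= e' * L by rewrite mulr_ge0 ?(ltW L0) ?(ltW e'0).
have e'LL : 0 <= e' * L * L by rewrite mulr_ge0 ?(ltW L0).
exists p => x xL; rewrite pE p1E; split.
- by rewrite (le_trans (h0 _ xL))//; lra.
- by rewrite (le_trans (h1 _ xL))//; lra.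
- by rewrite (le_trans (qE _ xL))//; lra.
Qed.

Lemma is_derive_mulr (c x : R) : is_derive x 1 (fun x => x * c) c.
Proof.
have := is_deriveZ c (is_derive_id x (1 : R)).
rewrite (_ : c \*: id = (fun x => x * c)); last first.
  by apply/funext => y; rewrite /= mulrC.
by move/is_derive_eq; apply; rewrite /GRing.scale/= mulr1.
Qed.

Lemma is_derive_sin_dilate (L x : R) : L != 0 ->
  is_derive x 1 (fun x => L * sin (x / L)) (cos (x / L)).
Proof.
move=> L0; have h := is_derive_mulr L^-1 x.
have h2 := @is_derive1_comp _ sin (fun x => x / L) x _ _ (is_derive_sin (x / L)) h.
have h3 := is_deriveZ L h2.
by apply: is_derive_eq; rewrite /GRing.scale/=; field.
Qed.

Lemma one_sub_cos_le (x : R) : 0 <= 1 - cos x <= `|x|.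
Proof.
rewrite subr_ge0 cos_le1/=.
have := @mean_value_le (@cos R) (fun x => - sin x) (- `|x|) `|x| 1 _ _ 0 x.
rewrite cos0 subr0 mul1r distrC => H.
rewrite (le_trans (ler_norm _))// H//.
- move=> y _; rewrite normrN; exact: sin_max.
- by rewrite oppr_le0 normr_ge0.
- by rewrite -ler_norml.
Qed.

(** The derivative of the difference is cos (x / L) - 1, of size at most
|x| / L. *)
Lemma sin_dilate_le (L r x : R) : 0 < L -> `|x| <= r ->
  `|L * sin (x / L) - x| <= r ^+ 2 / L.
Proof.
move=> L0 xr; have r0 : 0 <= r by rewrite (le_trans _ xr).
have := @mean_value_le (fun x => L * sin (x / L) - x) (fun x => cos (x / L) - 1)
  (- r) r (r / L) _ _ 0 x.
rewrite mul0r sin0 mulr0 !subr0 => H.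
apply: (le_trans (H _ _ _ _)).
- move=> y.
  exact: (is_deriveB (is_derive_sin_dilate y (lt0r_neq0 L0)) (is_derive_id y 1)).
- move=> y yr; rewrite distrC ger0_norm; last by case/andP: (one_sub_cos_le (y / L)).
  case/andP: (one_sub_cos_le (y / L)) => _ /le_trans; apply.
  by rewrite normrM normfV (gtr0_norm L0) ler_pM2r ?invr_gt0// ler_norml.
- by rewrite oppr_le0 r0.
- by rewrite -ler_norml.
- have -> : r ^+ 2 / L = r / L * r by ring.
  by rewrite ler_wpM2l// divr_ge0// ltW.
Qed.

(** Composing with y(x) = L sin (x / L) confines the argument to [- L, L],
where polynomials approximate, and does not enlarge the bounds: |y'| <= 1, and
the extra term p'(y) y'' is O(1 / L). *)
Lemma trig_approx_H2 h (eta r : R) : H2 h -> 0 < eta <= 1 -> 0 <= r ->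
  exists l : seq (R * R * R), [/\ forall x, `|trig l x| <= 2,
    forall x, `|trig (dtrig l) x| <= 1 + eta,
    forall x, `|trig (dtrig (dtrig l)) x| <= 1 + eta &
    forall x, `|x| <= r -> `|trig l x - h x| <= eta].
Proof.
move=> Hh /andP[eta0 eta1] r0.
have [dh dh1 ch2 hle] := H2_derive Hh.
(* large enough for |y x - x| <= eta / 2 on [- r, r] and |y''| <= eta / 4 *)
pose L := 1 + 2 * r ^+ 2 / eta + 4 / eta.
have r20 : 0 <= 2 * r ^+ 2 / eta by rewrite divr_ge0 ?mulr_ge0 ?sqr_ge0// ltW.
have e40 : 0 < 4 / eta by rewrite divr_gt0.
have L0 : 0 < L by rewrite /L; lra.
have L4 : L^-1 <= eta / 4.
  rewrite -[leRHS]invrK lef_pV2 ?posrE ?invr_gt0 ?divr_gt0//.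
  by rewrite invf_div /L; lra.
have Lr : r ^+ 2 / L <= eta / 2.
  rewrite ler_pdivrMr//.
  have -> : eta / 2 * L = eta / 2 + r ^+ 2 + 2.
    by rewrite /L; field; rewrite gt_eqF.
  by lra.
have eta40 : 0 < eta / 4 by rewrite divr_gt0.
have [p pE] := poly_approx_H2 Hh L0 eta40.
have [l lE] := @trig_poly_sin R p L (lt0r_neq0 L0).
pose y x := L * sin (x / L).
have yL x : - L <= y x <= L.
  by rewrite -ler_norml normrM gtr0_norm// ler_piMr ?sin_max// ltW.
have d1 x : trig (dtrig l) x = p^`().[y x] * cos (x / L).
  have h1 := @is_derive1_comp _ (horner p) y x _ _ (is_derive_poly p (y x))
    (@is_derive_sin_dilate L x (lt0r_neq0 L0)).
  have := is_derive_trig l x.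
  rewrite (_ : trig l = horner p \o y); last by apply/funext => z; exact: lE.
  move=> h2; rewrite -(@derive_val _ _ _ _ _ _ _ h2).
  by rewrite (@derive_val _ _ _ _ _ _ _ h1).
have d2 x : trig (dtrig (dtrig l)) x =
    p^`()^`().[y x] * cos (x / L) ^+ 2 - p^`().[y x] * sin (x / L) / L.
  have h1 := @is_derive1_comp _ (horner p^`()) y x _ _ (is_derive_poly p^`() (y x))
    (@is_derive_sin_dilate L x (lt0r_neq0 L0)).
  have hc : is_derive x 1 (fun x => cos (x / L)) (- sin (x / L) / L).
    exact: (@is_derive1_comp _ cos (fun x => x / L) x _ _ (is_derive_cos (x / L))
      (is_derive_mulr L^-1 x)).
  have h3 := is_deriveM h1 hc.
  have := is_derive_trig (dtrig l) x.
  rewrite (_ : trig (dtrig l) = (horner p^`() \o y) * (fun x => cos (x / L))); last first.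
    by apply/funext => z; exact: d1.
  move=> h2; rewrite -(@derive_val _ _ _ _ _ _ _ h2).
  rewrite (@derive_val _ _ _ _ _ _ _ h3) /= /GRing.scale/=.
  by ring.
have p0 x : `|p.[y x]| <= 1 + eta / 4.
  have [h1 _ _] := pE _ (yL x); have := hle 0%N (y x) isT => /= h2.
  by rewrite -(subrK (h (y x)) p.[y x]) (le_trans (ler_normD _ _))//; lra.
have p1 x : `|p^`().[y x]| <= 1 + eta / 4.
  have [_ h1 _] := pE _ (yL x); have := hle 1%N (y x) isT => /= h2.
  rewrite -(subrK (h^`()%classic (y x)) p^`().[y x]) (le_trans (ler_normD _ _))//.
  by lra.
have p2 x : `|p^`()^`().[y x]| <= 1 + eta / 4.
  have [_ _ h1] := pE _ (yL x); have := hle 2%N (y x) isT => h2.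
  rewrite -(subrK (h^`(2)%classic (y x)) p^`()^`().[y x]) (le_trans (ler_normD _ _))//.
  by lra.
exists l; split => x.
- by rewrite lE (le_trans (p0 x))//; lra.
- rewrite d1 normrM (@le_trans _ _ (1 + eta / 4))//; last lra.
  by rewrite (le_trans _ (p1 x))// ler_piMr// cos_max.
- rewrite d2 (le_trans (ler_normB _ _))//.
  have h1 : `|p^`()^`().[y x] * cos (x / L) ^+ 2| <= 1 + eta / 4.
    by rewrite normrM normrX (le_trans _ (p2 x))// ler_piMr// exprn_ile1// cos_max.
  have h2 : `|p^`().[y x] * sin (x / L) / L| <= 2 * (eta / 4).
    rewrite normrM; apply: ler_pM => //.
      rewrite normrM (@le_trans _ _ `|p^`().[y x]|)//; first by rewrite ler_piMr// sin_max.
      by rewrite (le_trans (p1 x))//; lra.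
    by rewrite normfV gtr0_norm.
  by lra.
- move=> xr; rewrite lE -/(y x).
  have [h1 _ _] := pE _ (yL x).
  rewrite (_ : _ - _ = (p.[y x] - h (y x)) + (h (y x) - h x)); last by ring.
  rewrite (le_trans (ler_normD _ _))//.
  have h2 : `|h (y x) - h x| <= eta / 2.
    have := @mean_value_le h _ (Num.min x (y x)) (Num.max x (y x)) 1 dh _ x (y x).
    rewrite mul1r => H; rewrite (le_trans (H _ _ _))//.
    + by move=> z _; exact: (hle 1%N).
    + by rewrite ge_min lexx le_max lexx.
    + by rewrite ge_min lexx le_max lexx !orbT.
    + by rewrite (le_trans (sin_dilate_le L0 xr)).
  by lra.
Qed.

End approximation.

(** * Measures given by a density *)
Section density.
Local Open Scope ereal_scope.
Context d1 d2 {S : measurableType d1} {T : measurableType d2} {R : realType}.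
Variables (mu : {measure set S -> \bar R}) (nu : {measure set T -> \bar R}).
Variables (phi : S -> T) (rho : S -> R).
Hypotheses (mphi : measurable_fun setT phi) (mrho : measurable_fun setT rho).
Hypothesis rho0 : forall x, (0 <= rho x)%R.
Hypothesis nuE : forall A, measurable A ->
  nu A = \int[mu]_(x in phi @^-1` A) (rho x)%:E.

Import HBNNSimple.

(** The map phi is the identity in the application below; it is there because
Lebesgue measure and the Levy measure are declared on two distinct, though
equal, measurable structures on the real line. *)
Lemma ge0_integral_density (f : T -> \bar R) :
  measurable_fun setT f -> (forall x, 0 <= f x) ->
  \int[nu]_x f x = \int[mu]_x (f (phi x) * (rho x)%:E).
Proof.
move=> mf f0; pose h := nnsfun_approx measurableT mf.
have mrhoE : measurable_fun setT (fun x => (rho x)%:E) by exact/measurable_EFinP.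
have hf x : (h n x)%:E @[n --> \oo] --> f x by exact: cvg_nnsfun_approx.
have mh n : measurable_fun setT (fun x => (h n (phi x))%:E).
  by apply/measurable_EFinP; exact: measurableT_comp.
transitivity (limn (fun n => \int[nu]_x (h n x)%:E)).
  rewrite -monotone_convergence//=.
  - by apply: eq_integral => x _; apply/esym/cvg_lim => //; exact: hf.
  - by move=> n; exact/measurable_EFinP.
  - by move=> n x _; rewrite lee_fin.
  - by move=> x _ m n mn; rewrite lee_fin; exact/lefP/nd_nnsfun_approx.
transitivity (limn (fun n => \int[mu]_x ((h n (phi x))%:E * (rho x)%:E))); last first.
  rewrite -monotone_convergence//=.
  - apply: eq_integral => x _; apply/cvg_lim => //.
    by apply: cvgeZr => //; exact: hf.
  - by move=> n; apply: emeasurable_funM.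
  - by move=> n x _; rewrite mule_ge0 ?lee_fin.
  - move=> x _ m n mn; rewrite lee_wpmul2r ?lee_fin//.
    exact/lefP/nd_nnsfun_approx.
congr (limn _); apply/funext => n.
have indic r : measurable_fun setT (fun x => (r * \1_(h n @^-1` [set r]) x)%:E).
  by apply/measurable_EFinP; exact: measurable_funM.
under eq_integral do rewrite fimfunE -fsumEFin//.
rewrite ge0_integral_fsum//; last by move=> *; exact: nnfun_muleindic_ge0.
under [RHS]eq_integral => x _.
  rewrite fimfunE -fsumEFin// ge0_mule_fsuml; last first.
    by move=> *; exact: nnfun_muleindic_ge0.
  over.
rewrite ge0_integral_fsum//; last 2 first.
  - by move=> r; apply: emeasurable_funM => //; exact: measurableT_comp (indic r) mphi.
  - by move=> r x _; rewrite mule_ge0 ?lee_fin// -lee_fin nnfun_muleindic_ge0.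
apply: eq_fsbigr => r rhn.
under eq_integral do rewrite EFinM.
under [RHS]eq_integral do rewrite EFinM -muleA.
have r0 : (0 <= r)%R by move: rhn; rewrite inE => -[t _ <-].
rewrite integralZl_indic_nnsfun// integral_indic// setIT nuE//.
rewrite ge0_integralZl//; last 2 first.
  - apply: emeasurable_funM => //; apply/measurable_EFinP.
    exact: measurableT_comp mphi.
  - by move=> t _; rewrite mule_ge0 ?lee_fin.
congr (_ * _); rewrite integral_mkcond; apply: eq_integral => x _.
rewrite patchE indicE.
rewrite (_ : (x \in phi @^-1` _) = (phi x \in h n @^-1` [set r])); last by [].
by case: (_ \in _); rewrite ?mul1e ?mul0e.
Qed.

Lemma integral_density (f : T -> \bar R) : measurable_fun setT f ->
  \int[nu]_x f x = \int[mu]_x (f (phi x) * (rho x)%:E).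
Proof.
move=> mf; rewrite [LHS]integralE [RHS]integralE.
rewrite (ge0_integral_density (measurable_funepos mf))//.
rewrite (ge0_integral_density (measurable_funeneg mf))//.
congr (_ - _); apply: eq_integral => x _.
  by rewrite !funeposE maxe_pMl// ?lee_fin// mul0e.
by rewrite !funenegE maxe_pMl// ?lee_fin// mul0e mulNe.
Qed.

Lemma integrable_density (f : T -> \bar R) : measurable_fun setT f ->
  nu.-integrable setT f <-> mu.-integrable setT (fun x => f (phi x) * (rho x)%:E).
Proof.
move=> mf.
have mfr : measurable_fun setT (fun x => f (phi x) * (rho x)%:E).
  apply: emeasurable_funM; last exact/measurable_EFinP.
  exact: measurableT_comp mf mphi.
have E : \int[nu]_x `|f x| = \int[mu]_x `|f (phi x) * (rho x)%:E|.
  rewrite ge0_integral_density//; last exact: measurableT_comp.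
  by apply: eq_integral => x _; rewrite abseM [X in _ = _ * X]gee0_abs// lee_fin.
by split=> /integrableP[_ h]; apply/integrableP; split => //; rewrite -?E// E.
Qed.

End density.

(** * Scaling of the Levy measure *)
Section lebesgue_scale.
Context {R : realType}.
Local Notation leb := (@lebesgue_measure R).

(** Lebesgue measure is determined by its values on intervals, so it is enough
to compare the lengths of an interval and of its preimage. *)
Lemma ge0_integral_lebesgue_scale (f : R -> \bar R) (z : R) : z != 0 ->
  measurable_fun setT f -> (forall u, 0 <= f u)%E ->
  (\int[leb]_u f u = `|z|%:E * \int[leb]_u f (z * u)%R)%E.
Proof.
move=> z0 mf f0.
have mz : measurable_fun setT ( *%R z : R -> R) by exact: measurable_funM.
pose phi : {mfun measurableTypeR R >-> measurableTypeR R} :=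
  HB.pack ( *%R z : R -> R)
    (@isMeasurableFun.Build _ _ (measurableTypeR R) (measurableTypeR R) _ mz).
unshelve epose (pf := (pushforward leb phi : {measure set (measurableTypeR R) -> \bar R})).
  exact: mz.
pose mu' : {measure set (measurableTypeR R) -> \bar R} :=
  mscale (NngNum (normr_ge0 z)) pf.
have pE (X : set R) : ocitv X -> leb X = mu' X.
  move=> [[a b]] _ <-; rewrite /mu'/= /mscale/= /pushforward/=.
  have [zp|zn] : 0 < z \/ z < 0 by apply/orP; rewrite orbC -neq_lt.
    rewrite (_ : _ @^-1` _ = `]a / z, b / z]%classic); last first.
      apply/seteqP; split => u /=; rewrite !in_itv/=;
        by rewrite ltr_pdivrMr// ler_pdivlMr// (mulrC u).
    rewrite !lebesgue_measure_itv/= !lte_fin ltr_pM2r ?invr_gt0//.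
    case: ifPn => ab; last by rewrite mule0.
    by rewrite -!EFinB -EFinM gtr0_norm//; congr EFin; field.
  rewrite (_ : _ @^-1` _ = `[b / z, a / z[%classic); last first.
    apply/seteqP; split => u /=; rewrite !in_itv/=;
      by rewrite ltr_ndivlMr// ler_ndivrMr// (mulrC u) andbC.
  rewrite !lebesgue_measure_itv/= !lte_fin ltr_nM2r ?invr_lt0//.
  case: ifPn => ab; last by rewrite mule0.
  by rewrite -!EFinB -EFinM ltr0_norm//; congr EFin; field.
rewrite (@eq_measure_integral _ _ _ setT mu' leb f); last first.
  move=> A mA _; exact: (lebesgue_measure_unique pE).
rewrite ge0_integral_mscale//; congr (_ * _)%E.
exact: (@ge0_integral_pushforward _ _ (measurableTypeR R) (measurableTypeR R) R _ mz leb setT f measurableT mf (fun y _ => f0 y)).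
Qed.

End lebesgue_scale.

Section levy.
Context {R : realType} (alpha : R) (m : {posnum R}).
Local Notation nu := (levy_measure alpha m).
Local Notation leb := (@lebesgue_measure R).
Local Notation dens := (levy_density alpha m).

Lemma levy_measureE (A : set R) : measurable A ->
  nu A = (\int[leb]_(u in A) (dens u)%:E)%E.
Proof.
move=> mA; rewrite (@ge0_negligible_integral _ _ _ leb _ [set (0 : R)])//.
- apply: measurable_funTS; apply/measurable_EFinP; exact: measurable_levy_density.
- by move=> u _; rewrite lee_fin levy_density_ge0.
- exact: lebesgue_measure_set1.
Qed.

Lemma integral_levyE (f : R -> \bar R) : measurable_fun setT f ->
  (\int[nu]_u f u = \int[leb]_u (f u * (dens u)%:E))%E.
Proof.
move=> mf; apply: (@integral_density _ _ (measurableTypeR R) R R leb nu idfun dens _ _ _ _ f mf).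
- exact: measurable_id.
- exact: measurable_levy_density.
- exact: levy_density_ge0.
- exact: levy_measureE.
Qed.

Lemma integrable_levyE (f : R -> \bar R) : measurable_fun setT f ->
  nu.-integrable setT f <-> leb.-integrable setT (fun u => f u * (dens u)%:E)%E.
Proof.
move=> mf; apply: (@integrable_density _ _ (measurableTypeR R) R R leb nu idfun dens _ _ _ _ f mf).
- exact: measurable_id.
- exact: measurable_levy_density.
- exact: levy_density_ge0.
- exact: levy_measureE.
Qed.

Lemma levy_density_scale (z u : R) : z != 0 ->
  dens u = `|z| `^ (1 + alpha) * dens (z * u).
Proof.
move=> z0; rewrite /levy_density normrM powRM//.
have -> : - 1 - alpha = - (1 + alpha) by ring.
rewrite !powRN [RHS]mulrCA mulVKf//.
by rewrite powR_eq0 normr_eq0 (negbTE z0).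
Qed.

(** Stability: the density is homogeneous of degree - 1 - alpha, and one of
these factors is absorbed by the change of variables. *)
Lemma ge0_integral_levy_scale (f : R -> \bar R) (z : R) : z != 0 ->
  measurable_fun setT f -> (forall u, 0 <= f u)%E ->
  (\int[nu]_u f (z * u)%R = (`|z| `^ alpha)%:E * \int[nu]_u f u)%E.
Proof.
move=> z0 mf f0.
have nz0 : 0 < `|z| by rewrite normr_gt0.
have mz : measurable_fun setT ( *%R z : R -> R) by exact: measurable_funM.
have md : measurable_fun setT (fun u => (dens u)%:E).
  by apply/measurable_EFinP; exact: measurable_levy_density.
rewrite !integral_levyE//; last exact: measurableT_comp.
rewrite [in RHS](ge0_integral_lebesgue_scale z0); last 2 first.
  - exact: emeasurable_funM.
  - by move=> u; rewrite mule_ge0// lee_fin levy_density_ge0.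
rewrite muleA -EFinM -ge0_integralZl ?lee_fin ?mulr_ge0 ?powR_ge0//; last 2 first.
  - apply: emeasurable_funM.
      exact: (measurableT_comp mf mz).
    exact: (measurableT_comp md mz).
  - by move=> u _; rewrite mule_ge0// lee_fin levy_density_ge0.
apply: eq_integral => u _; rewrite (levy_density_scale u z0).
rewrite [in LHS]EFinM [LHS]muleCA; congr (_ * _)%E; congr EFin.
rewrite powRD; last by apply/implyP; rewrite normr_eq0.
by rewrite powRr1// mulrC.
Qed.

Lemma integrable_levy_scale (f : R -> R) (z : R) : z != 0 ->
  nu.-integrable setT (EFin \o f) ->
  nu.-integrable setT (fun u => (f (z * u))%:E).
Proof.
move=> z0 /integrableP[mf fi].
have mz : measurable_fun setT ( *%R z : R -> R) by exact: measurable_funM.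
apply/integrableP; split; first exact: (measurableT_comp mf mz).
rewrite (@ge0_integral_levy_scale (fun u => `|(f u)%:E|%E))//; last first.
  exact: measurableT_comp.
by rewrite lte_mul_pinfty// lee_fin powR_ge0.
Qed.

Lemma Rintegral_levy_scale (f : R -> R) (z : R) : z != 0 ->
  nu.-integrable setT (EFin \o f) ->
  \int[nu]_u f (z * u) = `|z| `^ alpha * \int[nu]_u f u.
Proof.
move=> z0 fi.
have mf := measurable_int _ fi.
rewrite /Rintegral integralE [in RHS]integralE.
have -> : (\int[nu]_x ((fun u => (f (z * u))%:E)^\+ x) =
    (`|z| `^ alpha)%:E * \int[nu]_x ((EFin \o f)^\+ x))%E.
  rewrite -(ge0_integral_levy_scale z0)//; last exact: measurable_funepos.
  by apply: eq_integral => u _; rewrite !funeposE.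
have -> : (\int[nu]_x ((fun u => (f (z * u))%:E)^\- x) =
    (`|z| `^ alpha)%:E * \int[nu]_x ((EFin \o f)^\- x))%E.
  rewrite -(ge0_integral_levy_scale z0)//; last exact: measurable_funeneg.
  by apply: eq_integral => u _; rewrite !funenegE.
have p1 := integrable_pos_fin_num measurableT fi; have p2 := integrable_neg_fin_num measurableT fi.
rewrite -muleBr//; last by rewrite fin_num_adde_defr.
by rewrite fineM// fin_numB p1 p2.
Qed.

(** By reflection the positive and negative parts have the same integral I.  When
I is infinite, I - I is minus infinity by convention, and its real part is
again 0. *)
Lemma Rintegral_levy_odd (f : R -> R) : measurable_fun setT f ->
  (forall u, f (- u) = - f u) -> \int[nu]_u f u = 0.
Proof.
move=> mf fodd; rewrite /Rintegral integralE.
have mfE : measurable_fun setT (EFin \o f) by exact/measurable_EFinP.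
have -> : (\int[nu]_x ((EFin \o f)^\- x) = \int[nu]_x ((EFin \o f)^\+ x))%E.
  have N10 : (-1 : R) != 0 by rewrite oppr_eq0 oner_eq0.
  have := @ge0_integral_levy_scale (EFin \o f)^\+%E (-1) N10
    (measurable_funepos mfE) (fun _ => funepos_ge0 _ _).
  rewrite normrN1 powR1 mul1e => <-.
  apply: eq_integral => u _; rewrite funeposE funenegE/=.
  by rewrite mulN1r fodd.
have : (0 <= \int[nu]_x ((EFin \o f)^\+ x))%E.
  by apply: integral_ge0 => u _; rewrite funepos_ge0.
by case: (\int[nu]_x _)%E => [r||]//= _; rewrite subrr.
Qed.

End levy.

(** * Integrability against the Levy measure *)
Section ftc.
Context {R : realType}.
Local Notation leb := (@lebesgue_measure R).

Lemma FTC2_segment (f F : R -> R) (a b : R) : a < b ->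
  {within `[a, b], continuous f} ->
  (forall x, a <= x <= b -> is_derive x 1 F (f x)) ->
  (\int[leb]_(x in `[a, b]) (f x)%:E = (F b - F a)%:E)%E.
Proof.
move=> ab cf dF; rewrite (@continuous_FTC2 _ f F)//.
- have cF x : a <= x <= b -> {for x, continuous F}.
    move=> xab; apply: differentiable_continuous; apply/derivable1_diffP.
    by have /@ex_derive := dF x xab.
  split.
  + by move=> x; rewrite in_itv/= => /andP[ax xb];
      apply: (@ex_derive _ _ _ _ _ _ _ (dF x _)); rewrite !ltW.
  + by apply: cvg_at_right_filter; apply: cF; rewrite lexx ltW.
  + by apply: cvg_at_left_filter; apply: cF; rewrite lexx ltW.
- move=> x; rewrite in_itv/= => /andP[ax xb].
  by rewrite derive1E (@derive_val _ _ _ _ _ _ _ (dF x _))// !ltW.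
Qed.

Lemma integral_powR (p a b : R) : p + 1 != 0 -> 0 < a < b ->
  (\int[leb]_(x in `[a, b]) (x `^ p)%:E =
   ((b `^ (p + 1) - a `^ (p + 1)) / (p + 1))%:E)%E.
Proof.
move=> p0 /andP[a0 ab].
have cf : {within `[a, b], continuous (fun x : R => x `^ p)}.
  apply: derivable_within_continuous => x; rewrite in_itv/= => /andP[ax _].
  have x0 : 0 < x by exact: lt_le_trans ax.
  by have /@ex_derive := is_derive1_powR p x0.
have dF (x : R) : a <= x <= b ->
    is_derive x 1 (fun x : R => (p + 1)^-1 * x `^ (p + 1)) (x `^ p).
  move=> /andP[ax _]; have x0 : 0 < x by exact: lt_le_trans ax.
  have := is_deriveZ (p + 1)^-1 (is_derive1_powR (p + 1) x0).
  by move/is_derive_eq; apply; rewrite /GRing.scale/= addrK mulrA mulVf// mul1r.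
by rewrite (FTC2_segment ab cf dF); congr EFin; ring.
Qed.

End ftc.

Section levy_weight.
Context {R : realType} (alpha : R) (m : {posnum R}).
Hypothesis alpha12 : 1 < alpha < 2.
Local Notation nu := (levy_measure alpha m).
Local Notation leb := (@lebesgue_measure R).
Local Notation dens := (levy_density alpha m).

(** All functions integrated against the Levy measure are dominated by a
multiple of this one, which is u ^ 2 near 0 and |u| at infinity. *)
Definition weight (u : R) : R := `|u| * Num.min 1 `|u|.

Lemma weight_ge0 u : 0 <= weight u.
Proof. by rewrite mulr_ge0// le_min ler01 normr_ge0. Qed.

Lemma measurable_weight : measurable_fun setT weight.
Proof.
apply: measurable_funM; first exact: normr_measurable.
by apply: measurable_minr => //; exact: normr_measurable.
Qed.

Lemma le_weight (c1 c2 x u : R) : 0 <= c1 -> 0 <= c2 ->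
  x <= c1 * `|u| -> x <= c2 * u ^+ 2 -> x <= (c1 + c2) * weight u.
Proof.
move=> c10 c20 x1 x2; rewrite /weight -real_normK ?num_real// in x2 *.
have u0 := normr_ge0 u.
have [u1|u1] := leP 1 `|u|; first by rewrite mulr1; nra.
by nra.
Qed.

(** The integrand is m u^(1 - alpha) on ]0, 1] and m u^(- alpha) on [1, +oo[,
with integrals m / (2 - alpha) and m / (alpha - 1); the half-line is exhausted
by the intervals [1 / (i + 2), i + 2]. *)
Lemma integral_levy_pos_lty :
  (\int[leb]_(u in `]0%R, +oo[) (weight u * dens u)%:E < +oo)%E.
Proof.
move: alpha12 => /andP[a1 a2].
pose F (i : nat) : set R := `[(i.+2%:R)^-1, i.+2%:R]%classic.
have FE : \bigcup_i F i = `]0%R, +oo[%classic.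
  apply/seteqP; split => [u [i _]|u] /=; rewrite /F /= !in_itv/= ?andbT.
    by move=> /andP[+ _]; apply: lt_le_trans; rewrite invr_gt0.
  move=> u0; exists (Num.truncn (u + u^-1)) => //=.
  have h := truncnS_gt (u + u^-1).
  have ui0 : 0 < u^-1 by rewrite invr_gt0.
  have h2 : (Num.truncn (u + u^-1)).+2%:R = (Num.truncn (u + u^-1)).+1%:R + 1 :> R.
    by rewrite natr1.
  rewrite in_itv/=; apply/andP; split; last by rewrite h2; lra.
  by rewrite -[leRHS]invrK lef_pV2 ?posrE// h2; lra.
have mg : measurable_fun setT (fun u => (weight u * dens u)%:E).
  apply/measurable_EFinP; apply: measurable_funM; first exact: measurable_weight.
  exact: measurable_levy_density.
have g0 (u : R) : (0 <= (weight u * dens u)%:E)%E.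
  by rewrite lee_fin mulr_ge0 ?weight_ge0 ?levy_density_ge0.
pose M : R := m%:num / (2 - alpha) + m%:num / (alpha - 1).
have b1 (a : R) : 0 < a < 1 ->
    (\int[leb]_(u in `[a, 1%R]) (weight u * dens u)%:E <= (m%:num / (2 - alpha))%:E)%E.
  move=> a01; have /andP[a0 a01'] := a01.
  rewrite (eq_integral (fun u : measurableTypeR R => (m%:num)%:E * ((u : R) `^ (1 - alpha))%:E)%E); last first.
    move=> u; rewrite inE/= in_itv/= => /andP[au u1].
    have u0 : 0 < u by exact: lt_le_trans au.
    rewrite /weight /levy_density gtr0_norm// min_r// -EFinM; congr EFin.
    rewrite mulrCA; congr (_ * _).
    have -> : 1 - alpha = 2%:R + (-1 - alpha) by ring.
    rewrite [in RHS]powRD; last by apply/implyP => _; rewrite gt_eqF.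
    by rewrite powR_mulrn// ltW.
  rewrite ge0_integralZl_EFin//; last 2 first.
    - by move=> u _; rewrite lee_fin powR_ge0.
    - apply: measurable_funTS; apply/measurable_EFinP.
      exact: measurable_powR.
  rewrite integral_powR//; last by apply/eqP; lra.
  rewrite -EFinM lee_fin (_ : 1 - alpha + 1 = 2 - alpha); last by ring.
  rewrite ler_wpM2l// -[leRHS]mul1r ler_wpM2r ?invr_ge0//; first lra.
  by rewrite powR1 lerBlDr lerDl powR_ge0.
have b2 (b : R) : 1 < b ->
    (\int[leb]_(u in `[1%R, b]) (weight u * dens u)%:E <= (m%:num / (alpha - 1))%:E)%E.
  move=> b1'.
  rewrite (eq_integral (fun u : measurableTypeR R => (m%:num)%:E * ((u : R) `^ (- alpha))%:E)%E); last first.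
    move=> u; rewrite inE/= in_itv/= => /andP[u1 ub].
    have u0 : 0 < u by exact: lt_le_trans u1.
    rewrite /weight /levy_density gtr0_norm// min_l// mulr1 -EFinM; congr EFin.
    rewrite mulrCA; congr (_ * _).
    have -> : u `^ (- alpha) = u `^ (1 + (-1 - alpha)) by congr (_ `^ _); ring.
    rewrite [in RHS]powRD; last by apply/implyP => _; rewrite gt_eqF.
    by rewrite powRr1// ltW.
  rewrite ge0_integralZl_EFin//; last 2 first.
    - by move=> u _; rewrite lee_fin powR_ge0.
    - apply: measurable_funTS; apply/measurable_EFinP.
      exact: measurable_powR.
  rewrite integral_powR ?ltr01 ?b1'//; last by apply/eqP; lra.
  rewrite -EFinM lee_fin (_ : (- alpha + 1) = - (alpha - 1)); last by ring.
  rewrite ler_wpM2l// invrN mulrN -mulNr opprB -[leRHS]mul1r.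
  rewrite ler_wpM2r ?invr_ge0//; first lra.
  by rewrite powR1 lerBlDr lerDl powR_ge0.
rewrite -FE.
apply: (@le_lt_trans _ _ M%:E); last exact: ltry.
have nd : nondecreasing_seq F.
  move=> i j ij; apply/subsetPset => u; rewrite /F/= !in_itv/= => /andP[h1 h2].
  apply/andP; split; last by rewrite (le_trans h2)// ler_nat.
  by rewrite (le_trans _ h1)// lef_pV2 ?posrE// ler_nat.
have := @ge0_nondecreasing_set_cvg_integral _ (measurableTypeR R) R F
  (fun u => (weight u * dens u)%:E) leb nd (fun i => measurable_itv _)
  (fun i => measurable_funTS mg) (fun i u _ => g0 u).
move=> cv; rewrite -(cvg_lim _ cv)//; apply: lime_le; first by apply/cvg_ex; eexists; exact: cv.
apply: nearW => i.
have i1 : 1 < i.+2%:R :> R by rewrite ltr1n.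
have i0 : (0 : R) < (i.+2%:R : R)^-1 < (1 : R) by rewrite invr_gt0 ltr0n/= invf_lt1.
rewrite /F (@itv_bndbnd_setU _ _ _ (BRight 1)); last 2 first.
- by rewrite bnd_simp ltW//; case/andP: i0.
- by rewrite bnd_simp ltW.
rewrite ge0_integral_setU//=; last 2 first.
- exact: measurable_funTS.
- by apply/disj_setPRL => u /=; rewrite !in_itv/= => /andP[h1 _] /andP[_]; rewrite leNgt h1.
rewrite EFinD; apply: leeD; first exact: b1.
rewrite integral_itv_obnd_cbnd; first exact: b2.
exact: measurable_funTS.
Qed.

Lemma integrable_weight : nu.-integrable setT (EFin \o weight).
Proof.
have mw : measurable_fun setT (EFin \o weight).
  by apply/measurable_EFinP; exact: measurable_weight.
apply/integrableP; split => //.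
pose wp (u : R) : \bar R := (weight u * (0 < u)%R%:R)%:E.
have mp : measurable_fun setT (fun u : R => (0 < u)%R%:R : R).
  rewrite (_ : (fun u : R => _) = \1_(`]0, +oo[%classic : set R)).
    exact: measurable_indic.
  apply/funext => u; rewrite indicE; congr (_ : bool)%:R.
  by apply/idP/idP; rewrite inE/= in_itv/= andbT.
have mwp : measurable_fun setT wp.
  by apply/measurable_EFinP; apply: measurable_funM => //; exact: measurable_weight.
have wp0 u : (0 <= wp u)%E by rewrite lee_fin mulr_ge0 ?weight_ge0.
rewrite (eq_integral (fun u => wp u + wp (-1 * u)%R)%E); last first.
  move=> u _; rewrite /= /wp/= mulN1r oppr_gt0 -EFinD.
  rewrite (_ : weight (- u) = weight u); last by rewrite /weight normrN.
  rewrite ger0_norm ?weight_ge0// -mulrDr; congr EFin.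
  by have [u0|u0|->] := ltgtP u 0; rewrite ?add0r ?addr0 ?mulr1// /weight normr0 !mul0r.
have mN1 : measurable_fun setT ( *%R (-1) : R -> R) by exact: measurable_funM.
rewrite ge0_integralD//; last exact: measurableT_comp.
rewrite ge0_integral_levy_scale ?oppr_eq0 ?oner_eq0// normrN1 powR1 mul1e.
suff H : (\int[nu]_u wp u < +oo)%E by exact: lte_add_pinfty.
rewrite integral_levyE//.
apply: le_lt_trans integral_levy_pos_lty.
rewrite [leRHS]integral_mkcond; apply: ge0_le_integral => //.
- by move=> u _; rewrite mule_ge0// lee_fin levy_density_ge0.
- apply: emeasurable_funM => //; apply/measurable_EFinP.
  exact: measurable_levy_density.
- apply/(measurable_restrictT _ _).1 => //; apply: measurable_funTS.
  apply/measurable_EFinP; apply: measurable_funM; first exact: measurable_weight.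
  exact: measurable_levy_density.
- move=> u _; rewrite patchE /wp -EFinM.
  have -> : (u \in `]0, +oo[%classic) = (0 < u).
    by apply/idP/idP; rewrite inE/= in_itv/= andbT.
  by case: ifPn => _; rewrite ?mulr1// mulr0 mul0r.
Qed.

End levy_weight.

(** * Trigonometric integrals against the Levy measure *)
Section levy_trig.
Context {R : realType} (alpha : R) (m : {posnum R}).
Hypothesis alpha12 : 1 < alpha < 2.
Local Notation nu := (levy_measure alpha m).

Let a1 : 1 < alpha. Proof. by case/andP: alpha12. Qed.
Let a2 : alpha < 2. Proof. by case/andP: alpha12. Qed.

Lemma sin_le_norm (x : R) : `|sin x| <= `|x|.
Proof.
have := @mean_value_le R (@sin R) (@cos R) (- `|x|) `|x| 1 _ _ 0 x.
rewrite sin0 !subr0 mul1r; apply => //.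
- by move=> y _; exact: cos_max.
- by rewrite oppr_le0 normr_ge0.
- by rewrite -ler_norml.
Qed.

Lemma one_sub_cos_le_sqr (x : R) : 1 - cos x <= x ^+ 2.
Proof.
have := @mean_value_le R (@cos R) (fun x => - sin x) (- `|x|) `|x| `|x| _ _ 0 x.
rewrite cos0 subr0 -expr2 real_normK ?num_real// distrC => H.
rewrite (le_trans (ler_norm _))// H//.
- by move=> y; rewrite -ler_norml normrN; apply: le_trans; exact: sin_le_norm.
- by rewrite oppr_le0 normr_ge0.
- by rewrite -ler_norml.
Qed.

Definition levyC : R := \int[nu]_u weight u.
Definition levy_sin (w : R) : R := \int[nu]_u (u * sin (w * u)).
(** The exponent of the stable law: its characteristic function at z is
exp (- levy_cos z). *)
Definition levy_cos (z : R) : R := \int[nu]_u (1 - cos (z * u)).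

Lemma integrable_le_weight (f : R -> R) (c : R) : measurable_fun setT f ->
  (forall u, `|f u| <= c * weight u) -> nu.-integrable setT (EFin \o f).
Proof.
move=> mf fc; apply: (@le_integrable _ _ _ _ _ _ _ (fun u => c%:E * (weight u)%:E)%E) => //.
- exact/measurable_EFinP.
- move=> u _ /=; rewrite lee_fin (le_trans (fc u))//.
  exact: ler_norm.
- apply: integrableZl => //; exact: integrable_weight.
Qed.

Lemma measurable_cosM (z : R) : measurable_fun setT (fun u : R => cos (z * u)).
Proof.
apply: measurableT_comp; last exact: measurable_funM.
exact: continuous_measurable_fun (@continuous_cos R).
Qed.

Lemma measurable_sinM (z : R) : measurable_fun setT (fun u : R => sin (z * u)).
Proof.
apply: measurableT_comp; last exact: measurable_funM.
exact: continuous_measurable_fun (@continuous_sin R).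
Qed.

Lemma sin_weight (w u : R) : `|u * sin (w * u)| <= (1 + `|w|) * weight u.
Proof.
apply: le_weight => //; rewrite normrM.
  by rewrite mulrC ler_wpM2r// sin_max.
rewrite -real_normK ?num_real// expr2 mulrCA ler_wpM2l// -normrM.
exact: sin_le_norm.
Qed.

Lemma integrable_levy_sin (w : R) :
  nu.-integrable setT (EFin \o (fun u : R => u * sin (w * u))).
Proof.
apply: (@integrable_le_weight _ (1 + `|w|)); last exact: sin_weight.
apply: measurable_funM => //; exact: measurable_sinM.
Qed.

Lemma integrable_levy_cos (z : R) :
  nu.-integrable setT (EFin \o (fun u : R => 1 - cos (z * u))).
Proof.
apply: (@integrable_le_weight _ (`|z| + z ^+ 2)).
  by apply: measurable_funB => //; exact: measurable_cosM.
move=> u; have /andP[c0 c1] := one_sub_cos_le (z * u).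
rewrite ger0_norm//; apply: le_weight => //; first exact: sqr_ge0.
  by rewrite -normrM.
by rewrite -exprMn one_sub_cos_le_sqr.
Qed.

Lemma integrable_levy_cosM (z : R) :
  nu.-integrable setT (EFin \o (fun u : R => u * (1 - cos (z * u)))).
Proof.
apply: (@integrable_le_weight _ (2 + `|z|)).
  apply: measurable_funM => //; apply: measurable_funB => //; exact: measurable_cosM.
move=> u; have /andP[c0 c1] := one_sub_cos_le (z * u).
rewrite normrM (ger0_norm c0); apply: le_weight => //.
  rewrite mulrC ler_wpM2r//; have := cos_geN1 (z * u); lra.
rewrite -real_normK ?num_real// expr2 mulrCA ler_wpM2l//.
by rewrite -normrM.
Qed.

Lemma levy_cos_scale (z : R) : levy_cos z = `|z| `^ alpha * levy_cos 1.
Proof.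
have [->|z0] := eqVneq z 0.
  rewrite normr0 powR0 ?mul0r; last by apply/eqP; move: a1 a2; lra.
  rewrite /levy_cos; under eq_Rintegral do rewrite mul0r cos0 subrr.
  by rewrite Rintegral_cst// mul0r.
rewrite -(Rintegral_levy_scale z0 (integrable_levy_cos 1)).
by apply: eq_Rintegral => u _; rewrite mul1r.
Qed.

Lemma mul_levy_sin_scale (z : R) : z * levy_sin z = `|z| `^ alpha * levy_sin 1.
Proof.
have [->|z0] := eqVneq z 0.
  by rewrite mul0r normr0 powR0 ?mul0r//; apply/eqP; move: a1 a2; lra.
rewrite -(Rintegral_levy_scale z0 (integrable_levy_sin 1)).
rewrite -RintegralZl//; last exact: integrable_levy_sin.
by apply: eq_Rintegral => u _; rewrite mul1r mulrA.
Qed.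

(** Differentiate s |-> levy_cos s = s^alpha levy_cos 1 at s = 1 in two ways:
under the integral sign, and as a power. *)
Lemma levy_sin1 : levy_sin 1 = alpha * levy_cos 1.
Proof.
pose f (s u : R) := 1 - cos (s * u).
have df (s u : R) : is_derive s 1 (f ^~ u) (u * sin (s * u)).
  have h := is_derive_mulr u s.
  have h2 := @is_derive1_comp _ cos (fun s => s * u) s _ _ (is_derive_cos (s * u)) h.
  have h3 := is_deriveB (is_derive_cst (1 : R) s 1) h2.
  by apply: is_derive_eq; rewrite /GRing.scale/=; ring.
have pE (s u : R) : partial1of2 f s u = u * sin (s * u).
  by rewrite partial1of2E (@derive_val _ _ _ _ _ _ _ (df s u)).
have I1 : [set` `]0, 2[] (1 : R) by rewrite /= in_itv/=; lra.
have := @differentiation_under_integral R _ _ nu f setT measurableT 1 0 2 I1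
  (fun s _ => integrable_levy_cos s) (fun s u _ _ => @ex_derive _ _ _ _ _ _ _ (df s u))
  (fun u => 3 * weight u).
move=> /(_ _ _ _) H.
transitivity ((fun s => \int[nu]_u f s u)^`()%classic 1).
  rewrite H.
  - by apply: eq_Rintegral => u _; rewrite pE.
  - by move=> u; rewrite mulr_ge0// weight_ge0.
  - apply: (@integrable_le_weight _ 3).
      by apply: measurable_funM => //; exact: measurable_weight.
    by move=> u; rewrite ger0_norm// mulr_ge0// weight_ge0.
  - move=> s u; rewrite /= in_itv/= => /andP[s0 s2] _; rewrite pE.
    rewrite (le_trans (sin_weight _ _))// ler_wpM2r ?weight_ge0// gtr0_norm//.
    by lra.
have dp := is_deriveZ (levy_cos 1) (is_derive1_powR alpha (@ltr01 R)).
rewrite derive1E.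
rewrite (@near_eq_derive _ _ _ _ (levy_cos 1 \*: (@powR R ^~ alpha))); last first.
  near=> s.
  have s0 : 0 < s by near: s; exact: lt_nbhsr.
  by rewrite -[LHS]/(levy_cos s) levy_cos_scale gtr0_norm//; exact: mulrC.
by rewrite (@derive_val _ _ _ _ _ _ _ dp) powR1/= mulr1; exact: mulrC.
Unshelve. all: by end_near. Qed.

Lemma mul_levy_sin (z : R) : z * levy_sin z = alpha * levy_cos z.
Proof. by rewrite mul_levy_sin_scale levy_sin1 (levy_cos_scale z) mulrCA. Qed.

Lemma levy_cos_ge0 z : 0 <= levy_cos z.
Proof. by apply: Rintegral_ge0 => u _; case/andP: (one_sub_cos_le (z * u)). Qed.

Lemma levyC_ge0 : 0 <= levyC.
Proof. by apply: Rintegral_ge0 => u _; exact: weight_ge0. Qed.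

(** The integrand is c^2 weight (u / c), so scaling by 1 / c applies. *)
Lemma integral_levy_min (c : R) : 0 <= c ->
  \int[nu]_u (`|u| * Num.min c `|u|) = levyC * c `^ (2 - alpha).
Proof.
rewrite le_eqVlt => /predU1P[<-|c0].
  rewrite powR0; last by apply/eqP; move: a1 a2; lra.
  rewrite mulr0; under eq_Rintegral do rewrite min_l// mulr0.
  by rewrite Rintegral_cst// mul0r.
have ci0 : c^-1 != 0 by rewrite invr_eq0 gt_eqF.
have := Rintegral_levy_scale ci0 (integrable_weight m alpha12).
rewrite -/levyC => H.
have -> : levyC * c `^ (2 - alpha) = c ^+ 2 * (`|c^-1| `^ alpha * levyC).
  rewrite gtr0_norm ?invr_gt0// -[c^-1]powR_inv1 ?ltW// -powRrM mulN1r.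
  rewrite powRD; last by apply/implyP => _; rewrite gt_eqF.
  by rewrite powR_mulrn ?ltW//; ring.
rewrite -H -RintegralZl//; last exact: (integrable_levy_scale ci0 (integrable_weight m alpha12)).
apply: eq_Rintegral => u _; rewrite /weight normrM gtr0_norm ?invr_gt0//.
have -> : Num.min c `|u| = c * Num.min 1 (c^-1 * `|u|).
  by rewrite minr_pMr ?ltW// mulr1 mulVKf// gt_eqF.
by field; rewrite gt_eqF.
Qed.

(** Expanding cos (z (x + u) + theta), the cosine part of the increment is odd
in u after multiplication by u and integrates to 0; only the sine part is
left.  The Stein operator therefore acts on sums of cosines as a Fourier
multiplier. *)
Lemma levy_generator (l : seq (R * R * R)) (x : R) :
  \int[nu]_u (u * (trig l (x + u) - trig l x)) = trig (mult levy_sin (quarter l)) x.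
Proof.
rewrite trig_mult_quarter.
suff [] : nu.-integrable setT (EFin \o (fun u : R => u * (trig l (x + u) - trig l x))) /\
  \int[nu]_u (u * (trig l (x + u) - trig l x)) =
  - \sum_(w <- l) w.1.1 * levy_sin w.1.2 * sin (w.1.2 * x + w.2) by [].
rewrite /trig; elim: l => [|w l [ih1 ih2]].
  split.
    apply: (@integrable_le_weight _ 0).
      under eq_fun do rewrite !big_nil subrr mulr0.
      exact: measurable_cst.
    by move=> u; rewrite !big_nil subrr mulr0 normr0 mul0r.
  under eq_Rintegral do rewrite !big_nil subrr mulr0.
  by rewrite Rintegral_cst// mul0r big_nil oppr0.
pose A := w.1.1 * cos (w.1.2 * x + w.2); pose B := w.1.1 * sin (w.1.2 * x + w.2).
have E u : u * (\sum_(v <- w :: l) v.1.1 * cos (v.1.2 * (x + u) + v.2) -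
       \sum_(v <- w :: l) v.1.1 * cos (v.1.2 * x + v.2)) =
   ((- A) * (u * (1 - cos (w.1.2 * u))) + (- B) * (u * sin (w.1.2 * u))) +
   u * (\sum_(v <- l) v.1.1 * cos (v.1.2 * (x + u) + v.2) -
       \sum_(v <- l) v.1.1 * cos (v.1.2 * x + v.2)).
  rewrite !big_cons.
  have -> : w.1.2 * (x + u) + w.2 = (w.1.2 * x + w.2) + w.1.2 * u by ring.
  by rewrite cosD /A /B; ring.
have i1 : nu.-integrable setT (EFin \o (fun u : R => (- A) * (u * (1 - cos (w.1.2 * u))))).
  by apply: (@integrableZl _ _ _ nu _ measurableT (- A) _ (integrable_levy_cosM w.1.2)).
have i2 : nu.-integrable setT (EFin \o (fun u : R => (- B) * (u * sin (w.1.2 * u)))).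
  by apply: (@integrableZl _ _ _ nu _ measurableT (- B) _ (integrable_levy_sin w.1.2)).
have i12 : nu.-integrable setT (EFin \o (fun u : R =>
   (- A) * (u * (1 - cos (w.1.2 * u))) + (- B) * (u * sin (w.1.2 * u)))).
  exact: (integrableD measurableT i1 i2).
split.
  have := integrableD measurableT i12 ih1.
  apply: eq_integrable => // u _ /=; rewrite E -!EFinD; congr EFin.
under eq_Rintegral do rewrite E.
rewrite RintegralD// RintegralD// ih2.
rewrite RintegralZl//; last exact: integrable_levy_cosM.
rewrite RintegralZl//; last exact: integrable_levy_sin.
rewrite [X in - A * X]Rintegral_levy_odd; last 2 first.
- apply: measurable_funM => //; apply: measurable_funB => //; exact: measurable_cosM.
- by move=> u; rewrite mulrN cosN mulNr.
rewrite -/(levy_sin w.1.2) big_cons /B; ring.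
Qed.

End levy_trig.

(** * The kernels of Stein's method *)
Section kernel.
Context {R : realType}.
Local Notation leb := (@lebesgue_measure R).

(** Both kernels are averages of this function of u: K_i is its expectation at
u = Z_i, and K_nu its integral against the Levy measure. *)
Definition kern (t N u : R) : R :=
  u * [&& 0 <= t, t <= u & u <= N]%:R - u * [&& - N <= u, u <= t & t <= 0]%:R.

Lemma kern_ge0 t N u : 0 <= kern t N u.
Proof.
rewrite subr_ge0 /kern.
have [/and3P[_ ut t0]|_] := boolP [&& - N <= u, u <= t & t <= 0].
  have u0 : u <= 0 by exact: le_trans t0.
  have [/and3P[t0' tu _]|_] := boolP [&& 0 <= t, t <= u & u <= N].
    by rewrite !mulr1.
  by rewrite mulr1 mulr0.
rewrite mulr0; have [/and3P[t0' tu _]|_] := boolP [&& 0 <= t, t <= u & u <= N].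
  by rewrite mulr1 (le_trans t0').
by rewrite mulr0.
Qed.

Lemma kern_out t N u : ~~ (- N <= t <= N) -> kern t N u = 0.
Proof.
move=> tN; rewrite /kern.
have [/and3P[t0 tu uN]|_] := boolP [&& 0 <= t, t <= u & u <= N].
  exfalso; move/negP: tN; apply; rewrite (le_trans tu uN) andbT.
  by rewrite (le_trans _ t0)// oppr_le0 (le_trans t0)// (le_trans tu).
have [/and3P[Nu ut t0]|_] := boolP [&& - N <= u, u <= t & t <= 0].
  exfalso; move/negP: tN; apply; rewrite (le_trans Nu ut)/=.
  by rewrite (le_trans t0)// -oppr_le0 (le_trans Nu)// (le_trans ut).
by rewrite !mulr0 subr0.
Qed.

Lemma measurable_natr d (T : measurableType d) (b : T -> bool) :
  measurable_fun setT b -> measurable_fun setT (fun x => (b x)%:R : R).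
Proof.
move=> mb; rewrite (_ : (fun x => _) = (fun x => if b x then 1 else 0 : R)).
  exact: measurable_fun_ifT.
by apply/funext => x; case: (b x).
Qed.

Lemma measurable_gtN (N : R) : measurable_fun setT (fun u : R => (N < `|u|)%R%:R : R).
Proof.
by apply: measurable_natr; apply: measurable_fun_ltr => //; exact: normr_measurable.
Qed.

Lemma measurable_leN (N : R) : measurable_fun setT (fun u : R => (`|u| <= N)%R%:R : R).
Proof.
by apply: measurable_natr; apply: measurable_fun_ler => //; exact: normr_measurable.
Qed.

Lemma measurable_kern d (T : measurableType d) (N : R) (t u : T -> R) :
  measurable_fun setT t -> measurable_fun setT u ->
  measurable_fun setT (fun x => kern (t x) N (u x)).
Proof.
move=> mt mu; apply: measurable_funB; apply: measurable_funM => //;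
  apply: measurable_natr; apply: measurable_and;
  [|apply: measurable_and| |apply: measurable_and];
  exact: measurable_fun_ler.
Qed.

(** As t varies, [kern t N u] is |u| times the indicator of the segment between
0 and u, so this is the fundamental theorem of calculus on that segment. *)
Lemma integral_kern (k dk : R -> R) (N u : R) : 0 < N ->
  (forall x : R, is_derive x 1 k (dk x)) -> continuous dk ->
  (\int[leb]_t (kern t N u * dk t)%:E =
   (u * (`|u| <= N)%R%:R * (k u - k 0))%:E)%E.
Proof.
move=> N0 dkE cdk.
have cseg (a b c : R) : {within `[a, b], continuous (fun t => c * dk t)}.
  apply: continuous_subspaceT => x; apply: cvgM; first exact: cvg_cst.
  exact: cdk.
have dseg (a b c : R) (x : R) : a <= x <= b -> is_derive x 1 (c \*: k : R -> R) (c * dk x).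
  by move=> _; exact: is_deriveZ.
have [uN|uN] := boolP (`|u| <= N); last first.
  rewrite mulr0 mul0r; apply: integral0_eq => t _.
  rewrite /kern; move: uN; rewrite ler_norml negb_and.
  move=> /orP[/negbTE h|/negbTE h]; rewrite h/= ?andbF; last first.
    have [/and3P[Nu ut t0]|_] := boolP [&& - N <= u, u <= t & t <= 0].
      by exfalso; move: h; rewrite (le_trans ut)// (le_trans t0)// ltW.
    by rewrite !mulr0 subrr mul0r.
  have [/and3P[t0 tu _]|_] := boolP [&& 0 <= t, t <= u & u <= N].
    by exfalso; move: h; rewrite (le_trans _ tu)// (le_trans _ t0)// oppr_le0 ltW.
  by rewrite !mulr0 subrr mul0r.
rewrite mulr1; move: (uN); rewrite ler_norml => /andP[Nu uN'].
have [u0|u0|->] := ltgtP u 0; last first.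
- by rewrite mul0r; apply: integral0_eq => t _; rewrite /kern !mul0r subrr mul0r.
- transitivity (\int[leb]_(t in `[0%R, u]) (u * dk t)%:E)%E; last first.
    by rewrite (FTC2_segment u0 (cseg _ _ u) (dseg _ _ u)) /=; congr EFin; rewrite -scalerBr.
  rewrite [RHS]integral_mkcond; apply: eq_integral => t _.
  rewrite patchE /kern uN' Nu/= andbT.
  have -> : (t \in `[0, u]%classic) = (0 <= t) && (t <= u).
    by apply/idP/idP; rewrite inE/= in_itv.
  have -> : (u <= t) && (t <= 0) = false.
    by apply/negbTE/negP => /andP[h1 h2]; move: u0; rewrite ltNge (le_trans h1).
  by case: ifPn => _; rewrite /= ?mulr1n ?mulr0n ?mulr1 ?mulr0 ?subr0 ?mul0r.
- transitivity (\int[leb]_(t in `[u, 0%R]) (- u * dk t)%:E)%E; last first.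
    rewrite (FTC2_segment u0 (cseg _ _ (- u)) (dseg _ _ (- u))) /=; congr EFin.
    by rewrite -scalerBr /GRing.scale/=; ring.
  rewrite [RHS]integral_mkcond; apply: eq_integral => t _.
  rewrite patchE /kern uN' Nu/= andbT.
  have -> : (t \in `[u, 0]%classic) = (u <= t) && (t <= 0).
    by apply/idP/idP; rewrite inE/= in_itv.
  have -> : (0 <= t) && (t <= u) = false.
    by apply/negbTE/negP => /andP[h1 h2]; move: u0; rewrite ltNge (le_trans h1).
  by case: ifPn => _; rewrite /= ?mulr1n ?mulr0n ?mulr1 ?mulr0 ?sub0r ?oppr0 ?mul0r.
Qed.

Lemma ge0_integralZr_real d (T : measurableType d) (mu : {measure set T -> \bar R})
    (f : T -> R) (c : R) :
  measurable_fun setT f -> (forall x, 0 <= f x) ->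
  (\int[mu]_x (f x * c)%:E = (\int[mu]_x (f x)%:E) * c%:E)%E.
Proof.
move=> mf f0; have mfE : measurable_fun setT (fun x => (f x)%:E) by exact/measurable_EFinP.
wlog c0 : c / 0 <= c => [H|].
  have [c0|c0] := leP 0 c; first exact: H.
  rewrite -[c]opprK EFinN muleN -H ?oppr_ge0 ?ltW//.
  rewrite -integral_ge0N; last by move=> x _; rewrite lee_fin mulr_ge0// oppr_ge0 ltW.
  by apply: eq_integral => x _; rewrite -EFinN mulrN.
under eq_integral do rewrite EFinM.
by rewrite ge0_integralZr//; move=> x _; rewrite lee_fin.
Qed.

(** The two kernels are treated together: U is Z_i with rho = 1, or the identity
with rho the Levy density. *)
Section fubini.
Context d (T : measurableType d) (mu : {sigma_finite_measure set T -> \bar R}).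
Variables (U rho : T -> R) (N : R).
Hypotheses (mU : measurable_fun setT U) (mrho : measurable_fun setT rho).
Hypotheses (rho0 : forall x, 0 <= rho x) (N0 : 0 < N).
Hypothesis intU :
  mu.-integrable setT (EFin \o (fun x => U x ^+ 2 * (`|U x| <= N)%R%:R * rho x)).

Let K t := (\int[mu]_x (kern t N (U x) * rho x)%:E)%E.

Let mkern : measurable_fun setT
  (fun z : measurableTypeR R * T => kern z.1 N (U z.2) * rho z.2).
Proof.
apply: measurable_funM; last exact: measurableT_comp.
apply: (@measurable_kern _ (measurableTypeR R * T)%type) => //.
exact: measurableT_comp.
Qed.

(** Integrating the absolute value in t first gives the second moment of the
truncated U, by [integral_kern] with k the identity. *)
Let fubini_int (dk : R -> R) (B : R) : measurable_fun setT dk ->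
  (forall x, `|dk x| <= B) ->
  (leb \x mu)%E.-integrable setT
    (fun z : measurableTypeR R * T => (kern z.1 N (U z.2) * rho z.2 * dk z.1)%:E).
Proof.
move=> mdk dkB.
have B0 : 0 <= B by rewrite (le_trans _ (dkB 0)).
have mf : measurable_fun setT
    (fun z : measurableTypeR R * T => kern z.1 N (U z.2) * rho z.2 * dk z.1).
  by apply: measurable_funM => //; exact: measurableT_comp.
apply: (@le_integrable _ _ _ _ _ _ _
   (fun z : measurableTypeR R * T => (B * (kern z.1 N (U z.2) * rho z.2))%:E)) => //.
- exact/measurable_EFinP.
- move=> z _; rewrite !abse_EFin lee_fin normrM [leRHS]normrM (ger0_norm B0) mulrC.
  by rewrite ler_wpM2r.
apply/integrable21ltyP; first by apply/measurable_EFinP; exact: measurable_funM.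
move/integrableP: intU => [_ h].
apply: le_lt_trans (_ : (\int[mu]_x (B%:E * `|(U x ^+ 2 * (`|U x| <= N)%R%:R * rho x)%:E|) < +oo)%E).
  rewrite le_eqVlt; apply/orP; left; apply/eqP; apply: eq_integral => x _.
  have := @integral_kern id (cst 1) N (U x) N0 (fun x => is_derive_id x 1) (fun x => @cvg_cst _ _ _ _ _).
  move=> h1.
  transitivity (\int[leb]_t ((B * rho x)%:E * (kern t N (U x) * 1)%:E))%E.
    apply: eq_integral => t _ /=; rewrite ger0_norm.
      by rewrite -EFinM; congr EFin; ring.
    by rewrite !mulr_ge0// kern_ge0.
  rewrite ge0_integralZl_EFin//.
  - rewrite h1 subr0 -EFinM; congr EFin.
    rewrite ger0_norm; first by rewrite expr2; ring.
    by rewrite mulr_ge0// mulr_ge0// sqr_ge0.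
  - by move=> t _; rewrite mulr1 lee_fin kern_ge0.
  - apply/measurable_EFinP; apply: measurable_funM => //.
    exact: measurable_kern.
  - by rewrite mulr_ge0.
rewrite ge0_integralZl_EFin//; first by rewrite lte_mul_pinfty.
by move/integrableP: intU => [mm _]; exact: measurableT_comp.
Qed.

Lemma kernel_ge0 t : (0 <= K t)%E.
Proof. by apply: integral_ge0 => x _; rewrite lee_fin mulr_ge0 ?kern_ge0. Qed.

Lemma integrable_kernel : leb.-integrable setT K.
Proof.
have h1 (x : R) : `|(cst 1 : R -> R) x| <= 1 by rewrite /= normr1.
have := @integrable_fubini_F _ _ _ _ R leb mu _ (@fubini_int (cst 1) 1 (measurable_cst _) h1).
apply: eq_integrable => // t _; rewrite /fubini_F /K; apply: eq_integral => x _ /=.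
by rewrite mulr1.
Qed.

Lemma integral_kernel (k dk : R -> R) (B : R) :
  (forall x : R, is_derive x 1 k (dk x)) -> continuous dk ->
  (forall x, `|dk x| <= B) ->
  (\int[mu]_x (U x * (`|U x| <= N)%R%:R * (k (U x) - k 0) * rho x)%:E =
   \int[leb]_t (K t * (dk t)%:E))%E.
Proof.
move=> dkE cdk dkB.
have mdk : measurable_fun setT dk by exact: continuous_measurable_fun.
transitivity (\int[mu]_x \int[leb]_t (kern t N (U x) * rho x * dk t)%:E)%E.
  apply: eq_integral => x _.
  have dkE' (y : R) : is_derive y 1 (rho x \*: k : R -> R) (rho x * dk y).
    exact: is_deriveZ.
  have cdk' : continuous (fun y => rho x * dk y).
    by move=> y; apply: cvgM; [exact: cvg_cst|exact: cdk].
  transitivity (\int[leb]_t (kern t N (U x) * (rho x * dk t))%:E)%E.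
    rewrite (integral_kern (U x) N0 dkE' cdk'); congr EFin.
    by rewrite /= -scalerBr /GRing.scale/=; ring.
  by apply: eq_integral => t _; congr EFin; ring.
rewrite -(Fubini (fubini_int mdk dkB)); apply: eq_integral => t _.
rewrite /= ge0_integralZr_real//.
- apply: measurable_funM => //; exact: measurable_kern.
- by move=> x; rewrite mulr_ge0 ?kern_ge0.
Qed.

End fubini.
End kernel.

(** * Comparison of the two kernels *)
Section kernel_comparison.
Context {R : realType} (alpha : R) (m : {posnum R}).
Hypothesis alpha12 : 1 < alpha < 2.
Local Notation nu := (levy_measure alpha m).
Local Notation leb := (@lebesgue_measure R).
Local Notation dens := (levy_density alpha m).

(** This holds for every t, including t = 0, where both sides are infinite. *)
Lemma K_nuE (t N : R) :
  K_nu alpha m t N = (\int[leb]_u (kern t N u * dens u)%:E)%E.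
Proof.
have mk : measurable_fun setT (fun u => (kern t N u)%:E).
  by apply/measurable_EFinP; exact: measurable_kern.
transitivity (\int[nu]_u (kern t N u)%:E)%E; last first.
  by rewrite integral_levyE//; apply: eq_integral => u _; rewrite EFinM.
pose A (u : R) := u * [&& 0 <= t, t <= u & u <= N]%:R.
pose B (u : R) := - (u * [&& - N <= u, u <= t & t <= 0]%:R).
have mA : measurable_fun setT A.
  apply: measurable_funM => //; apply: measurable_natr.
  by do 2 (apply: measurable_and; first exact: measurable_fun_ler);
    exact: measurable_fun_ler.
have mB : measurable_fun setT B.
  apply: measurable_funN; apply: measurable_funM => //; apply: measurable_natr.
  by do 2 (apply: measurable_and; first exact: measurable_fun_ler);
    exact: measurable_fun_ler.
have A0 u : 0 <= A u.
  rewrite /A; have [/and3P[t0 tu _]|_] := boolP [&& 0 <= t, t <= u & u <= N].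
    by rewrite mulr1 (le_trans t0).
  by rewrite mulr0.
have B0 u : 0 <= B u.
  rewrite /B; have [/and3P[_ ut t0]|_] := boolP [&& - N <= u, u <= t & t <= 0].
    by rewrite mulr1 oppr_ge0 (le_trans ut).
  by rewrite mulr0 oppr0.
transitivity (\int[nu]_u ((A u)%:E + (B u)%:E))%E; last first.
  by apply: eq_integral => u _; rewrite -EFinD.
rewrite ge0_integralD//; try (by move=> u _; rewrite lee_fin); try exact/measurable_EFinP.
congr (_ + _)%E.
  have [/andP[t0 tN]|tN] := boolP (0 <= t <= N); last first.
    rewrite mul0e; apply/esym/integral0_eq => u _; rewrite /A.
    have [/and3P[t0 tu uN]|_] := boolP [&& 0 <= t, t <= u & u <= N].
      by move: tN; rewrite t0 (le_trans tu uN).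
    by rewrite mulr0.
  rewrite mul1e [LHS]integral_mkcond; apply: eq_integral => u _; rewrite patchE /A t0/=.
  have -> : (u \in `[t, N]%classic) = (t <= u) && (u <= N).
    by apply/idP/idP; rewrite inE/= in_itv.
  by case: ifPn => _; rewrite ?mulr1 ?mulr0.
have [/andP[Nt t0]|tN] := boolP (- N <= t <= 0); last first.
  rewrite mul0e; apply/esym/integral0_eq => u _; rewrite /B.
  have [/and3P[Nu ut t0]|_] := boolP [&& - N <= u, u <= t & t <= 0].
    by move: tN; rewrite t0 (le_trans Nu ut).
  by rewrite mulr0 oppr0.
rewrite mul1e [LHS]integral_mkcond; apply: eq_integral => u _; rewrite patchE /B t0/= andbT.
have -> : (u \in `[(- N)%R, t]%classic) = (- N <= u) && (u <= t).
  by apply/idP/idP; rewrite inE/= in_itv.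
by case: ifPn => _; rewrite ?mulr1 ?mulr0 ?oppr0.
Qed.

Lemma K_rvE d (T : measurableType d) (P : probability T R) (Z : T -> R) (t N : R) :
  K_rv P Z t N = (\int[P]_w (kern t N (Z w) * 1)%:E)%E.
Proof.
rewrite /K_rv unlock; apply: eq_integral => w _.
by rewrite mulr1.
Qed.

Lemma integrable_trunc_levy (N : R) : 0 < N -> leb.-integrable setT
  (EFin \o (fun u : R => (idfun u) ^+ 2 * (`|idfun u| <= N)%R%:R * dens u)).
Proof.
move=> N0.
have mf : measurable_fun setT (fun u : R => u ^+ 2 * (`|u| <= N)%R%:R).
  apply: measurable_funM; first exact: measurable_funX.
  by apply: measurable_natr; apply: measurable_fun_ler => //; exact: normr_measurable.
have [+ _] := @integrable_levyE R alpha m (EFin \o (fun u => u ^+ 2 * (`|u| <= N)%R%:R))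
  (proj2 (measurable_EFinP _ _) mf).
move=> H; suff {}H' : nu.-integrable setT (EFin \o (fun u => u ^+ 2 * (`|u| <= N)%R%:R)).
  by have := H H'; apply: eq_integrable => // u _ /=; rewrite EFinM.
apply: (@integrable_le_weight _ _ _ alpha12 _ (N + 1)) => // u.
rewrite ger0_norm; last by rewrite mulr_ge0// sqr_ge0.
apply: le_weight => //; first exact: ltW.
  have [uN|_] := boolP (`|u| <= N); last by rewrite mulr0 mulr_ge0// ltW.
  by rewrite mulr1 -real_normK ?num_real// expr2 ler_wpM2r.
by rewrite mul1r ler_piMr ?sqr_ge0// lern1 leq_b1.
Qed.

Lemma integrable_K_nu (N : R) : 0 < N ->
  leb.-integrable setT (fun t => K_nu alpha m t N).
Proof.
move=> N0; have := @integrable_kernel R _ _ leb idfun dens N (@measurable_id _ _ _)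
  (measurable_levy_density _ _) (levy_density_ge0 _ _) N0 (integrable_trunc_levy N0).
by apply: eq_integrable => // t _; rewrite K_nuE.
Qed.

Lemma K_nu_ge0 (t N : R) : (0 <= K_nu alpha m t N)%E.
Proof. by rewrite K_nuE; apply: kernel_ge0 => u; exact: levy_density_ge0. Qed.

Lemma integral_levy_kernel (k dk : R -> R) (B N : R) : 0 < N ->
  (forall x : R, is_derive x 1 k (dk x)) -> continuous dk ->
  (forall x, `|dk x| <= B) ->
  (\int[nu]_u (u * (`|u| <= N)%R%:R * (k u - k 0))%:E =
   \int[leb]_t (K_nu alpha m t N * (dk t)%:E))%E.
Proof.
move=> N0 dkE cdk dkB.
have ck : continuous k.
  move=> x; apply: differentiable_continuous; apply/derivable1_diffP.
  by have /@ex_derive := dkE x.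
under [RHS]eq_integral do rewrite K_nuE.
rewrite -(@integral_kernel R _ _ leb idfun dens N (@measurable_id _ _ _)
  (measurable_levy_density _ _) (levy_density_ge0 _ _) N0 (integrable_trunc_levy N0)
  k dk B dkE cdk dkB).
rewrite integral_levyE//; apply/measurable_EFinP.
apply: measurable_funM; first apply: measurable_funM => //.
  by apply: measurable_natr; apply: measurable_fun_ler => //; exact: normr_measurable.
by apply: measurable_funB => //; exact: continuous_measurable_fun.
Qed.

Section rv.
Context d (T : measurableType d) (P : probability T R) (Z : T -> R).
Hypothesis mZ : measurable_fun setT Z.

Lemma integrable_trunc_rv (N : R) : 0 < N ->
  P.-integrable setT
   (EFin \o (fun w => Z w ^+ 2 * (`|Z w| <= N)%R%:R * (fun=> 1) w)).
Proof.
move=> N0; apply: measurable_bounded_integrable => //.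
- exact: (le_lt_trans (probability_le1 P measurableT) (ltry 1)).
- apply: measurable_funM => //; apply: measurable_funM; first exact: measurable_funX.
  apply: measurable_natr; apply: measurable_fun_ler => //.
  exact: measurableT_comp.
- exists (N ^+ 2); split; first exact: num_real.
  move=> M NM w _ /=; rewrite mulr1 (le_trans _ (ltW NM))//.
  rewrite ger0_norm; last by rewrite mulr_ge0// sqr_ge0.
  have [uN|_] := boolP (`|Z w| <= N); last by rewrite mulr0 sqr_ge0.
  by rewrite mulr1 -real_normK ?num_real// ler_sqr ?nnegrE// ltW.
Qed.

Lemma integrable_K_rv (N : R) : 0 < N ->
  leb.-integrable setT (fun t => K_rv P Z t N).
Proof.
move=> N0; have := @integrable_kernel R _ _ P Z (fun=> 1) N mZ
  (@measurable_cst _ _ _ _ _ _) (fun=> ler01) N0 (integrable_trunc_rv N0).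
by apply: eq_integrable => // t _; rewrite K_rvE.
Qed.

Lemma K_rv_ge0 (t N : R) : (0 <= K_rv P Z t N)%E.
Proof. by rewrite K_rvE; apply: kernel_ge0 => u; exact: ler01. Qed.

Lemma integral_rv_kernel (k dk : R -> R) (B N : R) : 0 < N ->
  (forall x : R, is_derive x 1 k (dk x)) -> continuous dk ->
  (forall x, `|dk x| <= B) ->
  (\int[P]_w (Z w * (`|Z w| <= N)%R%:R * (k (Z w) - k 0))%:E =
   \int[leb]_t (K_rv P Z t N * (dk t)%:E))%E.
Proof.
move=> N0 dkE cdk dkB.
under [RHS]eq_integral do rewrite K_rvE.
rewrite -(@integral_kernel R _ _ P Z (fun=> 1) N mZ
  (@measurable_cst _ _ _ _ _ _) (fun=> ler01) N0 (integrable_trunc_rv N0)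
  k dk B dkE cdk dkB).
by apply: eq_integral => w _; rewrite mulr1.
Qed.

(** Both terms on the left are integrals of their kernel against dk; what remains
is |dk| <= B under the integral.  The kernels may be infinite at some t, hence
the case analysis at the end. *)
Lemma kernel_comparison (k dk : R -> R) (B N c : R) : 0 < N -> 0 < c ->
  (forall x : R, is_derive x 1 k (dk x)) -> continuous dk ->
  (forall x, `|dk x| <= B) ->
  (`| \int[P]_w (Z w * (`|Z w| <= N)%R%:R * (k (Z w) - k 0)) -
      c * \int[nu]_u (u * (`|u| <= N)%R%:R * (k u - k 0)) |%:E <=
   B%:E * \int[leb]_(t in `[(- N)%R, N])
      `| K_nu alpha m t N * c%:E - K_rv P Z t N |)%E.
Proof.
move=> N0 c0 dkE cdk dkB.
have B0 : 0 <= B by rewrite (le_trans _ (dkB 0)).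
have mdk : measurable_fun setT dk by exact: continuous_measurable_fun.
have bdk : [bounded dk x | x in [set: measurableTypeR R]].
  exists B; split; first exact: num_real.
  by move=> M BM x _ /=; rewrite (le_trans (dkB x))// ltW.
have i1 := integrable_K_nu N0; have i2 := integrable_K_rv N0.
have j1 : leb.-integrable setT (fun t => K_nu alpha m t N * (dk t)%:E)%E.
  exact: (@integrableMl _ _ _ leb setT measurableT _ dk i1 mdk bdk).
have j2 : leb.-integrable setT (fun t => K_rv P Z t N * (dk t)%:E)%E.
  exact: (@integrableMl _ _ _ leb setT measurableT _ dk i2 mdk bdk).
have j1c := @integrableZl _ _ _ leb setT measurableT c _ j1.
have mK1 := measurable_int _ i1; have mK2 := measurable_int _ i2.
have mD : measurable_fun setT (fun t => `|K_nu alpha m t N * c%:E - K_rv P Z t N|)%E.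
  apply: measurableT_comp => //; apply: emeasurable_funB => //.
  exact: emeasurable_funM.
rewrite /Rintegral (integral_rv_kernel N0 dkE cdk dkB) (integral_levy_kernel N0 dkE cdk dkB).
set I2 := (\int[leb]_t (K_rv P Z t N * (dk t)%:E))%E.
set I1 := (\int[leb]_t (K_nu alpha m t N * (dk t)%:E))%E.
have f1 : I1 \is a fin_num by exact: integrable_fin_num.
have f2 : I2 \is a fin_num by exact: integrable_fin_num.
have -> : `|fine I2 - c * fine I1|%:E = `|I2 - c%:E * I1|%E.
  by rewrite -{2}(fineK f1) -{2}(fineK f2) -EFinM -EFinB.
rewrite /I1 /I2 -integralZl// -integralB//.
apply: (le_trans (le_abse_integral _ _ _)) => //.
  by apply: emeasurable_funB; [exact: measurable_int j2|exact: measurable_int j1c].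
rewrite [in leRHS]integral_mkcond -ge0_integralZl//; last 2 first.
- by apply/(measurable_restrictT _ _).1 => //; exact: measurable_funTS.
- by move=> t _; apply: erestrict_ge0 => u _; exact: abse_ge0.
apply: ge0_le_integral => //.
- apply: measurableT_comp => //; apply: emeasurable_funB;
    [exact: measurable_int j2|exact: measurable_int j1c].
- apply: emeasurable_funM => //.
  by apply/(measurable_restrictT _ _).1 => //; exact: measurable_funTS.
move=> t _; rewrite patchE.
have [tN|tN] := boolP (- N <= t <= N); last first.
  have k0 u : kern t N u = 0 by exact: kern_out.
  rewrite K_nuE K_rvE.
  rewrite integral0_eq; last by move=> w _; rewrite k0 mul0r.
  rewrite integral0_eq; last by move=> w _; rewrite k0 mul0r.
  rewrite !mul0e mule0 sub0e oppe0 abse0 mule_ge0 ?lee_fin//.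
  by case: ifPn => // _; exact: abse_ge0.
rewrite ifT; last by rewrite inE/= in_itv.
have := K_nu_ge0 t N; have := K_rv_ge0 t N.
move: (K_nu alpha m t N) (K_rv P Z t N) => a b b0 a0.
have [d0|d0] := eqVneq (dk t) 0.
  by rewrite d0 !mule0 sube0 abse0 mule_ge0 ?lee_fin ?abse_ge0.
have Bp : 0 < B by rewrite (lt_le_trans _ (dkB t))// normr_gt0.
have yc : (+oo * c%:E = +oo :> \bar R)%E by rewrite gt0_mulye ?lte_fin.
have By : (B%:E * +oo = +oo :> \bar R)%E by rewrite gt0_muley ?lte_fin.
case: b b0 => [b| |]// b0; case: a a0 => [a| |]// a0.
- change (`|b * dk t - c * (a * dk t)|%:E <= (B * `|a * c - b|)%:E)%E; rewrite lee_fin.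
  rewrite (_ : b * dk t - c * (a * dk t) = (b - a * c) * dk t); last by ring.
  by rewrite normrM mulrC distrC ler_wpM2r.
- by rewrite yc /= By leey.
- by rewrite /= By leey.
- by rewrite yc /= By leey.
Qed.

End rv.
End kernel_comparison.

(** * Independence of a summand from the sum of the others *)
Section independence.
Context d (T : measurableType d) (R : realType) (P : probability T R).

Definition independent (U V : T -> R) : Prop := forall A B : set R,
  measurable A -> measurable B ->
  P (U @^-1` A `&` V @^-1` B) = (P (U @^-1` A) * P (V @^-1` B))%E.

Lemma measurable_preim (U : T -> R) (A : set R) :
  measurable_fun setT U -> measurable A -> measurable (U @^-1` A).
Proof. by move=> mU mA; rewrite -[X in measurable X]setTI; exact: mU. Qed.

Section rest.
Variables (n : nat) (Y : 'I_n -> {RV P >-> R}).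
Hypothesis indepY : mutually_independent P Y.

(** A pi-system generating the sigma-algebra of the variables Y j, j != i. *)
Definition cylinders (i : 'I_n) : set (set T) :=
  [set E | exists B : 'I_n -> set R, (forall j, measurable (B j)) /\
     E = \bigcap_(j in [set` ([set~ i])%SET]) (Y j @^-1` B j)].

Lemma measurable_cylinders i : cylinders i `<=` measurable.
Proof.
move=> E [B [mB ->]].
by apply: fin_bigcap_measurable => // j _; exact: measurable_preim.
Qed.

Lemma setI_closed_cylinders i : setI_closed (cylinders i).
Proof.
move=> _ _ [B [mB ->]] [C [mC ->]].
exists (fun j => B j `&` C j); split; first by move=> j; exact: measurableI.
by rewrite -bigcapI; apply: eq_bigcapr => j _; rewrite preimage_setI.
Qed.

Lemma cylinders_setT i : cylinders i setT.
Proof.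
exists (fun=> setT); split => //.
by apply/esym; rewrite -subTset => w _ j _.
Qed.

Lemma indep_cylinder i A E : measurable A -> cylinders i E ->
  P (Y i @^-1` A `&` E) = (P (Y i @^-1` A) * P E)%E.
Proof.
move=> mA [B [mB ->]].
pose B' j := if j == i then A else B j.
have mB' j : measurable (B' j) by rewrite /B'; case: ifP.
have := indepY [set: 'I_n]%SET mB'.
have B'i : B' i = A by rewrite /B' eqxx.
rewrite (bigD1 i (finset.in_setT i))/= {}B'i => H.
have -> : Y i @^-1` A `&` \bigcap_(j in [set` ([set~ i])%SET]) (Y j @^-1` B j) =
   \bigcap_(j in [set` [set: 'I_n]%SET]) (Y j @^-1` B' j).
  apply/seteqP; split => [w [wA wB] j _|w wB].
    rewrite /B'; have [->//|ji] := eqVneq j i.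
    by apply: wB; rewrite /= !inE.
  split; first by have := wB i; rewrite /B' eqxx; apply; rewrite /= inE.
  move=> j /=; rewrite !inE => ji; have := wB j; rewrite /B' (negbTE ji).
  by apply; rewrite /= inE.
rewrite H (indepY [set~ i]%SET mB); congr (_ * _)%E.
apply: eq_big => [j|j /andP[_ ji]]; last by rewrite /B' (negbTE ji).
by rewrite in_setC1 [X in X && _](_ : _ = true)//; exact: (finset.in_setT j).
Qed.

(** E |-> P (F & E) and E |-> P F * P E are finite measures that agree on a
pi-system. *)
Lemma indep_sigma i A E : measurable A -> <<s cylinders i >> E ->
  P (Y i @^-1` A `&` E) = (P (Y i @^-1` A) * P E)%E.
Proof.
move=> mA sE.
have mF : measurable (Y i @^-1` A) by exact: measurable_preim.
have PF0 : 0 <= fine (P (Y i @^-1` A)) by rewrite fine_ge0.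
have PFfin : P (Y i @^-1` A) \is a fin_num by exact: fin_num_measure.
pose m2 : {measure set T -> \bar R} := mscale (NngNum PF0) P.
have m2E C : m2 C = (P (Y i @^-1` A) * P C)%E by rewrite -[in RHS](fineK PFfin).
pose m1 : {measure set T -> \bar R} := mrestr P mF.
have m1E C : m1 C = P (Y i @^-1` A `&` C) by rewrite setIC.
have cov : \bigcup_(k : nat) [set: T] = setT by rewrite -subTset => w _; exists 0%N.
have m12 C : cylinders i C -> m1 C = m2 C.
  by move=> cC; rewrite m1E m2E indep_cylinder.
have fin (k : nat) : (m1 setT < +oo)%E.
  by rewrite m1E setIT (le_lt_trans (probability_le1 P mF))// ltry.
rewrite -m1E -m2E.
exact: (@g_sigma_algebra_measure_unique d R T (cylinders i)
  (@measurable_cylinders i) (fun=> setT) (fun=> cylinders_setT i) cov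
  m1 m2 (@setI_closed_cylinders i) m12 fin E sE).
Qed.

(** The sum is measurable for the sigma-algebra generated by the cylinders. *)
Lemma indep_rest i (a : 'I_n -> R) :
  independent (Y i) (fun w => \sum_(j < n | j != i) a j * Y j w).
Proof.
move=> A B mA mB; apply: indep_sigma => //.
pose G := g_sigma_algebraType (cylinders i).
have mY j : j != i -> measurable_fun setT (Y j : G -> R).
  move=> ji _ C mC; rewrite setTI; apply: sub_sigma_algebra.
  exists (fun k => if k == j then C else setT); split.
    by move=> k; case: ifP.
  apply/seteqP; split => [w wC k _|w H].
    by case: ifP => // /eqP ->.
  by have := H j; rewrite eqxx; apply; rewrite /= !inE.
have : measurable_fun setT (fun w : G => \sum_(j < n | j != i) a j * Y j w).
  under eq_fun do rewrite big_mkcond/=.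
  apply: measurable_sum => j; case ji : (j != i).
    by apply: measurable_funM => //; exact: mY.
  exact: measurable_cst.
by move=> mS; have := mS (@measurableT _ G) B mB; rewrite setTI.
Qed.

End rest.

Lemma independentZ (a : R) (U V : T -> R) :
  independent U V -> independent (fun w => a * U w) V.
Proof.
move=> h A B mA mB; have ma : measurable ( *%R a @^-1` A).
  by rewrite -[X in measurable X]setTI; apply: measurable_funM.
exact: (h _ _ ma mB).
Qed.

Section freeze.
Variables (V U : {RV P >-> R}) (k : R * R -> R).
Hypothesis indepUV : independent U V.
Hypothesis mk : measurable_fun setT k.
Hypothesis kint : P.-integrable setT (fun w => (k (V w, U w))%:E).
Hypothesis kint2 : forall v, P.-integrable setT (fun w => (k (v, U w))%:E).

(** The joint law of (V, U) is the product of the marginals, so this is Fubini's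
theorem after transfer to the product measure. *)
Lemma integral_freeze :
  P.-integrable setT (EFin \o (fun w => \int[P]_w' k (V w, U w'))) /\
  \int[P]_w k (V w, U w) = \int[P]_w (\int[P]_w' k (V w, U w')).
Proof.
have mVU : measurable_fun setT (fun w => (V w, U w)) by exact: measurable_fun_pair.
pose phi : {mfun T >-> (R * R)%type} :=
  HB.pack (fun w => (V w, U w)) (isMeasurableFun.Build _ _ _ _ _ mVU).
pose m1 := distribution P V; pose m2 := distribution P U.
pose mm := distribution P phi.
have prod X : measurable X -> (m1 \x m2)%E X = mm X.
  apply: product_measure_unique => A B mA mB.
  have E : phi @^-1` (A `*` B) = U @^-1` B `&` V @^-1` A.
    by apply/seteqP; split => w [? ?]; split.
  by transitivity (P (phi @^-1` (A `*` B))) => //; rewrite E indepUV// muleC.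
have mkE : measurable_fun setT (EFin \o k) by exact/measurable_EFinP.
have kmm : mm.-integrable setT (EFin \o k).
  exact: (@integrable_pushforward _ _ _ _ R phi mVU P setT (EFin \o k) mkE kint measurableT).
have kprod : (m1 \x m2)%E.-integrable setT (EFin \o k).
  move/integrableP: kmm => [_ h]; apply/integrableP; split => //.
  by rewrite (@eq_measure_integral _ _ _ setT mm)// => A mA _; exact: prod.
have inner v : (\int[m2]_u (k (v, u))%:E = (\int[P]_w' k (v, U w'))%:E)%E.
  have mkv : measurable_fun setT (fun u => (k (v, u))%:E).
    by apply/measurable_EFinP; exact: measurableT_comp.
  rewrite (@integral_pushforward _ _ _ _ R U (measurable_funP U) P setT _ mkv (kint2 v) measurableT).
  by rewrite /Rintegral fineK//; exact: integrable_fin_num (kint2 v).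
have FE : fubini_F m2 (EFin \o k) = (fun v => (\int[P]_w' k (v, U w'))%:E).
  by apply/funext => v; exact: inner.
have F1 := integrable_fubini_F kprod; rewrite FE in F1.
have F2 := integral12_prod_meas1 kprod; rewrite FE in F2.
have mF := measurable_int _ F1.
have iFV : P.-integrable setT (EFin \o (fun w => \int[P]_w' k (V w, U w'))).
  move/integrableP: F1 => [_ h]; apply/integrableP; split.
    exact: (measurableT_comp mF (measurable_funP V)).
  move: h; rewrite (@ge0_integral_pushforward _ _ _ _ R V (measurable_funP V) P setT)//.
  exact: measurableT_comp.
split => //; rewrite /Rintegral; congr fine.
transitivity (\int[mm]_z (k z)%:E)%E.
  by rewrite (@integral_pushforward _ _ _ _ R phi mVU P setT _ mkE kint measurableT).
rewrite -(@eq_measure_integral _ _ _ setT mm (m1 \x m2)%E); last first.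
  by move=> A mA _; exact: prod.
rewrite -F2.
by rewrite (@integral_pushforward _ _ _ _ R V (measurable_funP V) P setT _ mF iFV measurableT).
Qed.

End freeze.

End independence.

(** * Expectations and elementary bounds *)
Section probability_integrals.
Context d (T : measurableType d) (R : realType) (P : probability T R).
Implicit Types (U f g : T -> R).

Lemma integrable_bounded f (c : R) : measurable_fun setT f ->
  (forall w, `|f w| <= c) -> P.-integrable setT (EFin \o f).
Proof.
move=> mf fc; apply: measurable_bounded_integrable => //.
  exact: (le_lt_trans (probability_le1 P measurableT) (ltry 1)).
exists c; split; first exact: num_real.
by move=> M cM w _ /=; rewrite (le_trans (fc w))// ltW.
Qed.

Lemma integrable_le_norm f g (c : R) : measurable_fun setT f ->
  P.-integrable setT (EFin \o g) ->
  (forall w, `|f w| <= c * `|g w|) -> P.-integrable setT (EFin \o f).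
Proof.
move=> mf ig fg.
apply: (@le_integrable _ _ _ _ _ _ _ (fun w => c%:E * (g w)%:E)%E) => //.
- exact/measurable_EFinP.
- by move=> w _; rewrite lee_fin (le_trans (fg w))// normrM ler_wpM2r// ler_norm.
- exact: (integrableZl measurableT c ig).
Qed.

Lemma norm_Rintegral_le f (c : R) : P.-integrable setT (EFin \o f) ->
  (forall w, `|f w| <= c) -> `|\int[P]_w f w| <= c.
Proof.
move=> fi fc; rewrite (le_trans (le_normr_Rintegral _ _))//.
rewrite (@le_trans _ _ (\int[P]_(w in setT) c))//.
  apply: le_Rintegral => //; first exact: integrable_norm.
  exact: finite_measure_integrable_cst.
rewrite Rintegral_cst// [X in fine X](_ : _ = 1%E) ?mulr1//.
exact: probability_setT.
Qed.

Lemma norm_Rintegral_le_Rintegral f g : P.-integrable setT (EFin \o f) ->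
  P.-integrable setT (EFin \o g) ->
  (forall w, `|f w| <= g w) -> `|\int[P]_w f w| <= \int[P]_w g w.
Proof.
move=> fi gi fg; rewrite (le_trans (le_normr_Rintegral _ _))//.
by apply: le_Rintegral => //; exact: integrable_norm.
Qed.

(** |x|^p <= 1 + |x|. *)
Lemma integrable_norm_powR U (p : R) : 0 <= p <= 1 ->
  P.-integrable setT (EFin \o U) ->
  P.-integrable setT (EFin \o (fun w => `|U w| `^ p)).
Proof.
move=> /andP[p0 p1] Ui.
have mU : measurable_fun setT U by apply/measurable_EFinP; exact: measurable_int Ui.
have i1 : P.-integrable setT (EFin \o (fun w => 1 + `|U w|)).
  have := integrableD measurableT (finite_measure_integrable_cst P (1 : R) measurableT)
    (integrable_norm Ui).
  exact: eq_integrable.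
apply: (integrable_le_norm (c := 1) _ i1).
  apply: (measurableT_comp (measurable_powR p) (f := (@powR R ^~ p))).
  exact: measurableT_comp.
move=> w; rewrite mul1r (ger0_norm (powR_ge0 _ _)) /= [leRHS]ger0_norm ?addr_ge0//.
have [U1|U1] := leP 1 `|U w|.
  by rewrite (le_trans (ler_powR U1 p1))// powRr1// lerDr.
have : `|U w| `^ p <= 1 `^ p.
  by apply: ge0_ler_powR => //; rewrite ?nnegrE// ltW.
by rewrite powR1/=; have := normr_ge0 (U w); lra.
Qed.

Lemma integrable_tail_rv U (N : R) : P.-integrable setT (EFin \o U) ->
  P.-integrable setT (EFin \o (fun w => `|U w| * (N < `|U w|)%R%:R)).
Proof.
move=> Ui.
have mU : measurable_fun setT U by apply/measurable_EFinP; exact: measurable_int Ui.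
apply: (integrable_le_norm (c := 1) _ Ui).
  apply: measurable_funM; first exact: measurableT_comp.
  exact: (measurableT_comp (measurable_gtN N) mU).
move=> w; rewrite mul1r ger0_norm ?mulr_ge0// ler_piMr//.
by rewrite lern1 leq_b1.
Qed.

End probability_integrals.

Section trig_bounds.
Context {R : realType} (l : seq (R * R * R)) (A B : R).
Hypothesis qA : forall x, `|trig l x| <= A.
Hypothesis qB : forall x, `|trig (dtrig l) x| <= B.

Lemma trig_bound_ge0 : 0 <= A /\ 0 <= B.
Proof. by split; [rewrite (le_trans _ (qA 0))|rewrite (le_trans _ (qB 0))]. Qed.

Lemma trig_sub_le x y : `|trig l y - trig l x| <= 2 * A.
Proof.
rewrite (le_trans (ler_normB _ _))//; have := qA x; have := qA y; lra.
Qed.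

Lemma trig_lip x y : `|trig l y - trig l x| <= B * `|y - x|.
Proof.
apply: (@mean_value_le R (trig l) (trig (dtrig l)) (Num.min x y) (Num.max x y)).
- exact: is_derive_trig.
- by move=> z _; exact: qB.
- by rewrite ge_min lexx le_max lexx.
- by rewrite ge_min lexx le_max lexx !orbT.
Qed.

End trig_bounds.

(** * Bounds on the Stein operator *)
Section generator_bounds.
Context {R : realType} (alpha : R) (m : {posnum R}).
Hypothesis alpha12 : 1 < alpha < 2.
Local Notation nu := (levy_measure alpha m).
Local Notation leb := (@lebesgue_measure R).
Local Notation levyC := (levyC alpha m).
Local Notation generator l := (trig (mult (levy_sin alpha m) (quarter l))).

Definition levy_tail (N : R) : R := \int[nu]_u (`|u| * (N < `|u|)%R%:R).

Lemma integrable_levy_tail (N : R) : 0 < N ->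
  nu.-integrable setT (EFin \o (fun u : R => `|u| * (N < `|u|)%R%:R)).
Proof.
move=> N0; apply: (@integrable_le_weight _ _ _ alpha12 _ (1 + N^-1)).
  by apply: measurable_funM; [exact: normr_measurable|exact: measurable_gtN].
move=> u; rewrite ger0_norm ?mulr_ge0//; apply: le_weight => //.
- by rewrite invr_ge0 ltW.
- by rewrite mul1r ler_piMr// lern1 leq_b1.
have [uN|_] := boolP (N < `|u|).
  rewrite mulr1 -real_normK ?num_real// expr2 mulrA ler_peMl//.
  by rewrite ler_pdivlMl// mulr1 ltW.
by rewrite mulr0 mulr_ge0 ?sqr_ge0// invr_ge0 ltW.
Qed.

Variables (l : seq (R * R * R)) (A B : R).
Hypothesis qA : forall x, `|trig l x| <= A.
Hypothesis qB : forall x, `|trig (dtrig l) x| <= B.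
Local Notation q := (trig l).

Let A0 : 0 <= A. Proof. by case: (trig_bound_ge0 qA qB). Qed.
Let B0 : 0 <= B. Proof. by case: (trig_bound_ge0 qA qB). Qed.

Lemma measurable_trig_shift (v : R) : measurable_fun setT (fun u => q (v + u)).
Proof.
by apply: measurableT_comp; [exact: measurable_trig|exact: measurable_funD].
Qed.

Lemma levy_jump_le (v u : R) :
  `|u * (q (v + u) - q v)| <= (2 * A + B) * weight u.
Proof.
rewrite normrM; apply: le_weight => //; first by rewrite mulr_ge0.
  by rewrite mulrC ler_wpM2r// (trig_sub_le qA).
rewrite -real_normK ?num_real// expr2 mulrCA ler_wpM2l//.
by rewrite (le_trans (trig_lip qB _ _))// addrAC subrr add0r.
Qed.

Lemma integrable_levy_jump (v : R) :
  nu.-integrable setT (EFin \o (fun u : R => u * (q (v + u) - q v))).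
Proof.
apply: (@integrable_le_weight _ _ _ alpha12 _ (2 * A + B)); last exact: levy_jump_le.
apply: measurable_funM => //; apply: measurable_funB => //.
exact: measurable_trig_shift.
Qed.

Lemma integrable_levy_jump_trunc (N v : R) :
  nu.-integrable setT (EFin \o (fun u : R => u * (`|u| <= N)%R%:R * (q (v + u) - q v))).
Proof.
apply: (@integrable_le_weight _ _ _ alpha12 _ (2 * A + B)).
  apply: measurable_funM.
    by apply: measurable_funM => //; exact: measurable_leN.
  by apply: measurable_funB => //; exact: measurable_trig_shift.
move=> u; rewrite (le_trans _ (levy_jump_le v u))// mulrAC normrM ler_piMr//.
by rewrite ger0_norm// lern1 leq_b1.
Qed.

(** The second-order increment of q over the steps z and u is at most
2 B min (|z|, |u|): pair its four terms either along u or along z. *)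
Lemma generator_holder (v z : R) :
  `|generator l (v + z) - generator l v| <= 2 * B * levyC * `|z| `^ (2 - alpha).
Proof.
rewrite -!(levy_generator m alpha12) -RintegralB//; [|exact: integrable_levy_jump..].
have mi : nu.-integrable setT (EFin \o (fun u : R => `|u| * Num.min `|z| `|u|)).
  apply: (@integrable_le_weight _ _ _ alpha12 _ (`|z| + 1)).
    apply: measurable_funM; first exact: normr_measurable.
    by apply: measurable_minr => //; exact: normr_measurable.
  move=> u; rewrite ger0_norm ?mulr_ge0 ?le_min ?normr_ge0//.
  apply: le_weight => //.
    by rewrite mulrC ler_wpM2r// ge_min lexx.
  by rewrite mul1r -real_normK ?num_real// expr2 ler_wpM2l// ge_min lexx orbT.
have -> : 2 * B * levyC * `|z| `^ (2 - alpha) =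
    \int[nu]_u (2 * B * (`|u| * Num.min `|z| `|u|)).
  by rewrite RintegralZl// (integral_levy_min m alpha12)// mulrA.
rewrite (le_trans (le_normr_Rintegral _ _))//.
  have := integrableB measurableT (integrable_levy_jump (v + z)) (integrable_levy_jump v).
  exact: eq_integrable.
apply: le_Rintegral => //.
- apply: (@integrable_norm _ _ _ _ _ (fun u : R => u * (q (v + z + u) - q (v + z)) - u * (q (v + u) - q v))).
  have := integrableB measurableT (integrable_levy_jump (v + z)) (integrable_levy_jump v).
  exact: eq_integrable.
- have := integrableZl measurableT (2 * B) mi.
  exact: eq_integrable.
move=> u _; rewrite -mulrBr normrM mulrCA ler_wpM2l//.
rewrite minr_pMr ?mulr_ge0// le_min; apply/andP; split.
  have -> : q (v + z + u) - q (v + z) - (q (v + u) - q v) =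
    (q (v + z + u) - q (v + u)) - (q (v + z) - q v) by ring.
  rewrite (le_trans (ler_normB _ _))//.
  have := trig_lip qB (v + u) (v + z + u); have := trig_lip qB v (v + z).
  have -> : v + z + u - (v + u) = z by ring.
  have -> : v + z - v = z by ring.
  by lra.
rewrite (le_trans (ler_normB _ _))//.
have := trig_lip qB (v + z) (v + z + u); have := trig_lip qB v (v + u).
have -> : v + z + u - (v + z) = u by ring.
have -> : v + u - v = u by ring.
by lra.
Qed.

(** Only jumps with |u| > N survive in the difference, and there q varies by at
most 2 A. *)
Lemma generator_trunc (N v : R) : 0 < N ->
  `|generator l v - \int[nu]_u (u * (`|u| <= N)%R%:R * (q (v + u) - q v))| <=
  2 * A * levy_tail N.
Proof.
move=> N0; rewrite -(levy_generator m alpha12) -RintegralB//; last 2 first.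
- exact: integrable_levy_jump.
- exact: integrable_levy_jump_trunc.
have ii := integrableB measurableT (integrable_levy_jump v) (integrable_levy_jump_trunc N v).
rewrite (le_trans (le_normr_Rintegral _ _))//.
rewrite /levy_tail -RintegralZl//; last exact: integrable_levy_tail.
apply: le_Rintegral => //.
- exact: (@integrable_norm _ _ _ _ _ (fun u : R =>
    u * (q (v + u) - q v) - u * (`|u| <= N)%R%:R * (q (v + u) - q v))).
- have := integrableZl measurableT (2 * A) (integrable_levy_tail N0).
  exact: eq_integrable.
move=> u _; rewrite ltNge; case: (`|u| <= N) => /=.
  by rewrite mulr1 subrr normr0 mulr0n !mulr0.
rewrite mulr0n mulr0 mul0r subr0 mulr1n mulr1 normrM mulrC ler_wpM2r//.
exact: (trig_sub_le qA).
Qed.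

End generator_bounds.

(** * The estimate for one summand *)
Section stein_pair.
Context {R : realType} (alpha : R) (m : {posnum R}).
Hypothesis alpha12 : 1 < alpha < 2.
Local Notation nu := (levy_measure alpha m).
Local Notation leb := (@lebesgue_measure R).
Local Notation levyC := (levyC alpha m).
Local Notation generator l := (trig (mult (levy_sin alpha m) (quarter l))).
Context d (T : measurableType d) (P : probability T R).
Variables (l : seq (R * R * R)) (A B : R).
Hypothesis qA : forall x, `|trig l x| <= A.
Hypothesis qB : forall x, `|trig (dtrig l) x| <= B.
Local Notation q := (trig l).

Let A0 : 0 <= A. Proof. by case: (trig_bound_ge0 qA qB). Qed.
Let B0 : 0 <= B. Proof. by case: (trig_bound_ge0 qA qB). Qed.

Definition kernel_dist (Z : T -> R) (c N : R) : \bar R :=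
  (\int[leb]_(t in `[(- N)%R, N]) `| K_nu alpha m t N * c%:E - K_rv P Z t N |)%E.

Lemma kernel_dist_fin_num (Z : T -> R) (c N : R) :
  measurable_fun setT Z -> 0 < N -> kernel_dist Z c N \is a fin_num.
Proof.
move=> mZ N0.
have i1 := integrable_K_nu m alpha12 N0; have i2 := integrable_K_rv P mZ N0.
have j1 := @integrableZr _ _ _ leb setT measurableT c _ i1.
have ii := integrableB measurableT j1 i2.
apply: integrable_fin_num => //; apply: integrable_abse.
by apply: (@integrableS _ _ _ leb setT) => //; exact: ii.
Qed.

Lemma kernel_dist_ge0 (Z : T -> R) (c N : R) : (0 <= kernel_dist Z c N)%E.
Proof. by apply: integral_ge0 => t _; exact: abse_ge0. Qed.

Variables V U : {RV P >-> R}.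
Hypothesis indepUV : independent P U V.
Hypothesis Ui : P.-integrable setT (EFin \o U).
Hypothesis U0 : \int[P]_w U w = 0.

Let mU : measurable_fun setT U. Proof. exact: measurable_funP. Qed.
Let mV : measurable_fun setT V. Proof. exact: measurable_funP. Qed.
Let mq (W : T -> R) : measurable_fun setT W -> measurable_fun setT (fun w => q (W w)).
Proof. by move=> mW; apply: measurableT_comp => //; exact: measurable_trig. Qed.

Lemma integrable_mul_trig (W : T -> R) : measurable_fun setT W ->
  P.-integrable setT (EFin \o (fun w => U w * q (W w))).
Proof.
move=> mW; apply: (integrable_le_norm (c := A) _ Ui).
  by apply: measurable_funM => //; exact: mq.
by move=> w; rewrite normrM mulrC ler_wpM2r.
Qed.

(** E[U q(V)] = E[U] E[q(V)] = 0. *)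
Lemma stein_decouple :
  \int[P]_w (U w * q (V w + U w)) = \int[P]_w (U w * (q (V w + U w) - q (V w))).
Proof.
have h : \int[P]_w (U w * q (V w)) = 0.
  have mk : measurable_fun setT (fun x : R * R => x.2 * q x.1).
    by apply: measurable_funM => //; apply: measurableT_comp => //; exact: measurable_trig.
  have ki (v : R) : P.-integrable setT (EFin \o (fun w => U w * q v)).
    exact: (@integrable_mul_trig (fun=> v)).
  have [_] := @integral_freeze _ _ _ P V U (fun x => x.2 * q x.1) indepUV mk
    (integrable_mul_trig mV) ki.
  move=> ->; under eq_Rintegral => w _.
    by rewrite /= RintegralZr// U0 mul0r; over.
  by rewrite Rintegral_cst// mul0r.
have mVU : measurable_fun setT (fun w => V w + U w) by exact: measurable_funD.
transitivity (\int[P]_w (U w * q (V w + U w) - U w * q (V w))).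
  by rewrite RintegralB//; [rewrite h subr0|exact: integrable_mul_trig..].
by apply: eq_Rintegral => w _; rewrite mulrBr.
Qed.

(** The four terms on the right come, in order, from |U| > N, from jumps larger
than N, from the kernels, and from replacing V + U by V in the Stein operator.
Since U is frozen out before the kernels are compared, the comparison is
needed only for a deterministic shift v. *)
Lemma stein_pair (N c : R) : 0 < N -> 0 < c ->
  `|\int[P]_w (U w * q (V w + U w)) - c * \int[P]_w generator l (V w + U w)| <=
  2 * A * \int[P]_w (`|U w| * (N < `|U w|)%R%:R)
  + 2 * A * c * levy_tail alpha m N
  + B * fine (kernel_dist U c N)
  + 2 * B * levyC * c * \int[P]_w (`|U w| `^ (2 - alpha)).
Proof.
move=> N0 c0.
have mVU : measurable_fun setT (fun w => V w + U w) by exact: measurable_funD.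
have mle : measurable_fun setT (fun w => (`|U w| <= N)%R%:R : R).
  exact: (measurableT_comp (measurable_leN N) mU).
have mgt : measurable_fun setT (fun w => (N < `|U w|)%R%:R : R).
  exact: (measurableT_comp (measurable_gtN N) mU).
have mdq (V' : T -> R) : measurable_fun setT V' ->
    measurable_fun setT (fun w => q (V' w + U w) - q (V' w)).
  by move=> mV'; apply: measurable_funB; apply: mq => //; exact: measurable_funD.
have i3 (V' : T -> R) : measurable_fun setT V' -> P.-integrable setT
    (EFin \o (fun w => U w * (`|U w| <= N)%R%:R * (q (V' w + U w) - q (V' w)))).
  move=> mV'; apply: (integrable_le_norm (c := 2 * A) _ Ui).
    by apply: measurable_funM; [exact: measurable_funM|exact: mdq].
  move=> w; rewrite mulrAC normrM (@le_trans _ _ `|U w * (q (V' w + U w) - q (V' w))|)//.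
    by rewrite ler_piMr// ger0_norm// lern1 leq_b1.
  by rewrite normrM mulrC ler_wpM2r// (trig_sub_le qA).
have i4 : P.-integrable setT
    (EFin \o (fun w => U w * (N < `|U w|)%R%:R * (q (V w + U w) - q (V w)))).
  apply: (integrable_le_norm (c := 2 * A) _ Ui).
    by apply: measurable_funM; [exact: measurable_funM|exact: mdq].
  move=> w; rewrite mulrAC normrM (@le_trans _ _ `|U w * (q (V w + U w) - q (V w))|)//.
    by rewrite ler_piMr// ger0_norm// lern1 leq_b1.
  by rewrite normrM mulrC ler_wpM2r// (trig_sub_le qA).
have igen (W : T -> R) : measurable_fun setT W ->
    P.-integrable setT (EFin \o (fun w => generator l (W w))).
  move=> mW; apply: integrable_bounded => [|w]; last exact: trig_le.
  by apply: measurableT_comp => //; exact: measurable_trig.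
pose J v := \int[P]_w' (U w' * (`|U w'| <= N)%R%:R * (q (v + U w') - q v)).
have [iJ EJ] : P.-integrable setT (EFin \o (fun w => J (V w))) /\
    \int[P]_w (U w * (`|U w| <= N)%R%:R * (q (V w + U w) - q (V w))) =
    \int[P]_w J (V w).
  apply: (@integral_freeze _ _ _ P V U
    (fun x => x.2 * (`|x.2| <= N)%R%:R * (q (x.1 + x.2) - q x.1)) indepUV).
  - apply: measurable_funM.
      apply: measurable_funM => //.
      exact: (measurableT_comp (measurable_leN N)).
    apply: measurable_funB; apply: measurableT_comp => //; try exact: measurable_trig.
    exact: measurable_funD.
  - exact: i3.
  - by move=> v; apply: (i3 (fun=> v)).
have Jbound v : `|J v - c * generator l v| <=
    B * fine (kernel_dist U c N) + 2 * A * c * levy_tail alpha m N.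
  pose HN := \int[nu]_u (u * (`|u| <= N)%R%:R * (q (v + u) - q v)).
  have dk (x : R) : is_derive x 1 (fun u => q (v + u)) (trig (dtrig l) (v + x)).
    have h0 : is_derive x 1 (fun u : R => v + u) 1.
      have := is_deriveD (is_derive_cst v x (1 : R)) (is_derive_id x (1 : R)).
      by rewrite add0r.
    have h1 := @is_derive1_comp _ q (fun u => v + u) x _ _ (is_derive_trig l (v + x)) h0.
    by move: h1; rewrite mulr1.
  have cdk : continuous (fun u => trig (dtrig l) (v + u)).
    move=> x; apply: continuous_comp; last exact: continuous_trig.
    by apply: cvgD; [exact: cvg_cst|exact: cvg_id].
  have := @kernel_comparison R alpha m alpha12 _ _ P U mU _ _ B N c N0 c0 dk cdk
    (fun x => qB (v + x)).
  rewrite -/(kernel_dist U c N) -(fineK (kernel_dist_fin_num c mU N0)) -EFinM lee_fin.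
  rewrite addr0 -/(J v) -/HN => h1.
  have h2 := generator_trunc m alpha12 qA qB v N0.
  rewrite -/HN in h2.
  rewrite (_ : J v - c * generator l v = (J v - c * HN) - c * (generator l v - HN)); last by ring.
  rewrite (le_trans (ler_normB _ _))// lerD// normrM (gtr0_norm c0).
  rewrite (le_trans (ler_wpM2l (ltW c0) h2))//.
  by rewrite le_eqVlt; apply/orP; left; apply/eqP; ring.
rewrite stein_decouple.
pose x4 := \int[P]_w (U w * (N < `|U w|)%R%:R * (q (V w + U w) - q (V w))).
have -> : \int[P]_w (U w * (q (V w + U w) - q (V w))) = \int[P]_w J (V w) + x4.
  rewrite -EJ -RintegralD//; last exact: i3.
  apply: eq_Rintegral => w _; rewrite ltNge.
  by case: (`|U w| <= N); rewrite /= ?mulr1n ?mulr0n; ring.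
have hx4 : `|x4| <= 2 * A * \int[P]_w (`|U w| * (N < `|U w|)%R%:R).
  have ir := integrable_tail_rv N Ui.
  rewrite -RintegralZl//; apply: norm_Rintegral_le_Rintegral => //.
    have := integrableZl measurableT (2 * A) ir.
    exact: eq_integrable.
  move=> w; rewrite mulrC normrM normrM (ger0_norm (ler0n _ _)).
  by rewrite ler_wpM2r ?mulr_ge0// (trig_sub_le qA).
have hH : `|\int[P]_w generator l (V w + U w) - \int[P]_w generator l (V w)| <=
    2 * B * levyC * \int[P]_w (`|U w| `^ (2 - alpha)).
  have ip : P.-integrable setT (EFin \o (fun w => `|U w| `^ (2 - alpha))).
    apply: integrable_norm_powR => //; case/andP: alpha12; lra.
  rewrite -RintegralB//; [|exact: igen..].
  rewrite -RintegralZl//; apply: norm_Rintegral_le_Rintegral => //.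
  - have := integrableB measurableT (igen _ mVU) (igen _ mV).
    exact: eq_integrable.
  - have := integrableZl measurableT (2 * B * levyC) ip.
    exact: eq_integrable.
  - by move=> w; apply: (generator_holder m alpha12 qA qB).
have hJ : `|\int[P]_w J (V w) - c * \int[P]_w generator l (V w)| <=
    B * fine (kernel_dist U c N) + 2 * A * c * levy_tail alpha m N.
  rewrite -RintegralZl//; last exact: igen.
  have icg : P.-integrable setT (EFin \o (fun w => c * generator l (V w))).
    have := integrableZl measurableT c (igen _ mV).
    exact: eq_integrable.
  rewrite -RintegralB//; apply: norm_Rintegral_le => //.
  have := integrableB measurableT iJ icg.
  exact: eq_integrable.
set E1 := \int[P]_w J (V w) in hJ *.
set G1 := \int[P]_w generator l (V w + U w) in hH *.
set G0 := \int[P]_w generator l (V w) in hH hJ *.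
have -> : E1 + x4 - c * G1 = (E1 - c * G0) + x4 - c * (G1 - G0) by ring.
rewrite (le_trans (ler_normB _ _))//.
have h1 : `|c * (G1 - G0)| <= 2 * B * levyC * c * \int[P]_w (`|U w| `^ (2 - alpha)).
  rewrite normrM (gtr0_norm c0) (le_trans (ler_wpM2l (ltW c0) hH))//.
  by rewrite le_eqVlt; apply/orP; left; apply/eqP; ring.
have h2 := ler_normD (E1 - c * G0) x4.
lra.
Qed.

End stein_pair.

(** * The estimate for the sum *)
Section stein_sum.
Context {R : realType} (alpha : R) (m : {posnum R}).
Hypothesis alpha12 : 1 < alpha < 2.
Local Notation generator l := (trig (mult (levy_sin alpha m) (quarter l))).
Context d (T : measurableType d) (P : probability T R).
Variables (n : nat) (Y : 'I_n -> {RV P >-> R}) (a : R).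
Hypothesis n0 : (0 < n)%N.
Hypothesis indepY : mutually_independent P Y.
Hypothesis Yi : forall i, P.-integrable setT (EFin \o Y i).
Hypothesis Y0 : forall i, \int[P]_w Y i w = 0.

Let Z i w := a * Y i w.
Let S w := \sum_(i < n) Z i w.

Lemma measurable_summand i : measurable_fun setT (Z i).
Proof. by apply: measurable_funM => //; exact: measurable_funP. Qed.

Lemma integrable_summand i : P.-integrable setT (EFin \o Z i).
Proof.
have := integrableZl measurableT a (Yi i).
exact: eq_integrable.
Qed.

Lemma measurable_total : measurable_fun setT S.
Proof. by apply: measurable_sum => i; exact: measurable_summand. Qed.

Lemma integrable_total : P.-integrable setT (EFin \o S).
Proof.
have := @integrable_sum _ _ _ P setT measurableT _ (index_enum 'I_n) predT
  (fun i w => (Z i w)%:E) (fun i _ => integrable_summand i).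
by apply: eq_integrable => // w _; rewrite /= sumEFin.
Qed.

(** The Stein operator, evaluated at S, is shared equally among the summands:
apply [stein_pair] with c = 1 / n to each Z_i and S - Z_i. *)
Lemma stein_sum (l : seq (R * R * R)) (A B N : R) : 0 < N ->
  (forall x, `|trig l x| <= A) -> (forall x, `|trig (dtrig l) x| <= B) ->
  `|\int[P]_w (S w * trig l (S w) - generator l (S w))| <=
  2 * A * (levy_tail alpha m N + \sum_(i < n) \int[P]_w (`|Z i w| * (N < `|Z i w|)%R%:R))
  + B * (\sum_(i < n) fine (kernel_dist alpha m P (Z i) n%:R^-1 N)
    + 2 * levyC alpha m / n%:R * \sum_(i < n) \int[P]_w (`|Z i w| `^ (2 - alpha))).
Proof.
move=> N0 qA qB.
have nR0 : 0 < n%:R :> R by rewrite ltr0n.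
have c0 : 0 < n%:R^-1 :> R by rewrite invr_gt0.
have mS := measurable_total.
have igen : P.-integrable setT (EFin \o (fun w => generator l (S w))).
  apply: integrable_bounded => [|w]; last exact: trig_le.
  by apply: measurableT_comp => //; exact: measurable_trig.
have iZq i : P.-integrable setT (EFin \o (fun w => Z i w * trig l (S w))).
  apply: (integrable_le_norm (c := A) _ (integrable_summand i)).
    apply: measurable_funM; first exact: measurable_summand.
    by apply: measurableT_comp => //; exact: measurable_trig.
  by move=> w; rewrite normrM mulrC ler_wpM2r.
pose V i w := \sum_(j < n | j != i) Z j w.
have mV i : measurable_fun setT (V i).
  rewrite /V; under eq_fun do rewrite big_mkcond/=.
  apply: measurable_sum => j; case: (j != i); last exact: measurable_cst.
  exact: measurable_summand.
have SE i w : S w = V i w + Z i w by rewrite /S (bigD1 i)//= addrC.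
have pair i : `|\int[P]_w (Z i w * trig l (S w)) - n%:R^-1 * \int[P]_w generator l (S w)| <=
  2 * A * \int[P]_w (`|Z i w| * (N < `|Z i w|)%R%:R)
  + 2 * A * n%:R^-1 * levy_tail alpha m N
  + B * fine (kernel_dist alpha m P (Z i) n%:R^-1 N)
  + 2 * B * levyC alpha m * n%:R^-1 * \int[P]_w (`|Z i w| `^ (2 - alpha)).
  pose U' : {RV P >-> R} := HB.pack (Z i)
    (isMeasurableFun.Build _ _ _ _ _ (measurable_summand i)).
  pose V' : {RV P >-> R} := HB.pack (V i)
    (isMeasurableFun.Build _ _ _ _ _ (mV i)).
  have ind : independent P U' V'.
    exact: (independentZ a (indep_rest indepY i (fun=> a))).
  have U0 : \int[P]_w U' w = 0.
    by rewrite /= RintegralZl// Y0 mulr0.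
  have e1 : \int[P]_w (Z i w * trig l (S w)) = \int[P]_w (U' w * trig l (V' w + U' w)).
    by apply: eq_Rintegral => w _; rewrite (SE i).
  have e2 : \int[P]_w generator l (S w) = \int[P]_w generator l (V' w + U' w).
    by apply: eq_Rintegral => w _; rewrite (SE i).
  rewrite e1 e2.
  exact: (@stein_pair R alpha m alpha12 _ _ P l A B qA qB V' U' ind
    (integrable_summand i) U0 N n%:R^-1 N0 c0).
have E : \int[P]_w (S w * trig l (S w) - generator l (S w)) =
  \sum_(i < n) (\int[P]_w (Z i w * trig l (S w)) - n%:R^-1 * \int[P]_w generator l (S w)).
  have iS : P.-integrable setT (EFin \o (fun w => S w * trig l (S w))).
    apply: (integrable_le_norm (c := A) _ integrable_total).
      by apply: measurable_funM => //; apply: measurableT_comp => //; exact: measurable_trig.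
    by move=> w; rewrite normrM mulrC ler_wpM2r.
  rewrite RintegralB// sumrB sumr_const card_ord -[X in _ = _ - X]mulr_natl mulrA mulfV ?gt_eqF// mul1r.
  congr (_ - _).
  have := @integral_sum _ _ _ P setT measurableT _
    (fun i w => (Z i w * trig l (S w))%:E) iZq (index_enum 'I_n) predT.
  move=> H; apply: EFin_inj; rewrite -sumEFin /Rintegral fineK; last exact: integrable_fin_num.
  under [RHS]eq_bigr do rewrite fineK ?(integrable_fin_num _ (iZq _))//.
  rewrite -H; apply: eq_integral => w _.
  by rewrite sumEFin /S mulr_suml.
rewrite E (le_trans (ler_norm_sum _ _ _))// (le_trans (ler_sum _ (fun i _ => pair i)))//.
rewrite !big_split/= -!mulr_sumr sumr_const card_ord.
rewrite -[levy_tail alpha m N *+ n]mulr_natl.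
rewrite le_eqVlt; apply/orP; left; apply/eqP; field.
by rewrite gt_eqF.
Qed.

End stein_sum.

(** * Smoothing by the stable law *)
Section stable_law.
Context {R : realType} (alpha : R) (m : {posnum R}).
Hypothesis alpha12 : 1 < alpha < 2.
Local Notation nu := (levy_measure alpha m).
Local Notation levy_cos := (levy_cos alpha m).
Context d (T : measurableType d) (Q : probability T R) (X : {RV Q >-> R}).
Hypothesis stableX : symmetric_stable alpha m Q X.

Let a1 : 1 < alpha. Proof. by case/andP: alpha12. Qed.

(** The compensated sine in the imaginary part of the exponent is odd, so the
characteristic function is real. *)
Lemma stable_cos_sin (z : R) :
  \int[Q]_w cos (z * X w) = expR (- levy_cos z) /\ \int[Q]_w sin (z * X w) = 0.
Proof.
have := stableX z; rewrite /characteristic_function /cintegral.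
set I1 := \int[nu]_x complex.Re _.
set I2 := \int[nu]_x complex.Im _.
have -> : I1 = - levy_cos z.
  rewrite /I1 /levy_cos -[RHS]mulN1r -RintegralZl//; last exact: integrable_levy_cos.
  apply: eq_Rintegral => u _ /=.
  by rewrite !mul0r !mul1r subrr expR0 !subr0 !mul1r mulN1r opprB add0r.
have -> : I2 = 0.
  rewrite (_ : I2 = \int[nu]_u (sin (z * u) - z * u * (`|u| <= 1)%R%:R)).
    apply: Rintegral_levy_odd.
      apply: measurable_funB; first exact: measurable_sinM.
      apply: measurable_funM; last exact: measurable_leN.
      exact: measurable_funM.
    by move=> u; rewrite normrN mulrN sinN; ring.
  apply: eq_Rintegral => u _ /=.
  by rewrite !mul0r !mul1r subrr expR0 !subr0 !mul1r !add0r.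
rewrite /cexp/= cos0 sin0 mulr1 mulr0 => -[h1 h2]; split.
  rewrite -h1; apply: eq_Rintegral => w _ /=.
  by rewrite !mul0r !mul1r subrr expR0 add0r mul1r.
apply: etrans (etrans h2 (mulr0 _)); apply: eq_Rintegral => w _ /=.
by rewrite !mul0r !mul1r subrr expR0 add0r mul1r.
Qed.

(** The value exp (- psi (sigma z)) with sigma = (1 - s^alpha)^(1 / alpha), where
psi is [levy_cos]. *)
Definition damping (s z : R) : R := expR (- (levy_cos z * (1 - s `^ alpha))).

Lemma integrable_trig_rv (l : seq (R * R * R)) (W : T -> R) : measurable_fun setT W ->
  Q.-integrable setT (EFin \o (fun w => trig l (W w))).
Proof.
move=> mW; apply: integrable_bounded => [|w]; last exact: trig_le.
by apply: measurableT_comp => //; exact: measurable_trig.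
Qed.

(** E sin (z X) = 0, hence E cos (a + z X) = cos a E cos (z X). *)
Lemma stable_smoothing (l : seq (R * R * R)) (s y : R) : 0 <= s <= 1 ->
  trig (mult (damping s) l) y =
  \int[Q]_w trig l (y + (1 - s `^ alpha) `^ alpha^-1 * X w).
Proof.
move=> /andP[s0 s1]; set sigma := (1 - s `^ alpha) `^ alpha^-1.
have alpha0 : 0 < alpha by exact: lt_trans a1.
have s1' : 0 <= 1 - s `^ alpha.
  rewrite subr_ge0 (@le_trans _ _ (1 `^ alpha))//; last by rewrite powR1.
  by apply: ge0_ler_powR; rewrite ?nnegrE// ltW.
have sE : `|sigma| `^ alpha = 1 - s `^ alpha.
  rewrite ger0_norm ?powR_ge0// /sigma -powRrM mulVf ?gt_eqF//.
  by rewrite powRr1.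
have dE z : expR (- levy_cos (z * sigma)) = damping s z.
  rewrite (levy_cos_scale m alpha12 (z * sigma)) normrM powRM// sE.
  by rewrite /damping (levy_cos_scale m alpha12 z) mulrAC.
have mX : measurable_fun setT X by exact: measurable_funP.
have mcos z : Q.-integrable setT (EFin \o (fun w => cos (z * X w))).
  apply: (@integrable_bounded _ _ _ Q _ 1) => [|w]; last exact: cos_max.
  exact: (measurableT_comp (measurable_cosM z) mX).
have msin z : Q.-integrable setT (EFin \o (fun w => sin (z * X w))).
  apply: (@integrable_bounded _ _ _ Q _ 1) => [|w]; last exact: sin_max.
  exact: (measurableT_comp (measurable_sinM z) mX).
have mshift : measurable_fun setT (fun w => y + sigma * X w).
  by apply: measurable_funD => //; exact: measurable_funM.
elim: l => [|w l ih].
  rewrite /trig big_nil; under eq_Rintegral do rewrite big_nil.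
  by rewrite Rintegral_cst// mul0r.
pose C := w.1.1 * cos (w.1.2 * y + w.2); pose D := w.1.1 * sin (w.1.2 * y + w.2).
transitivity (\int[Q]_v ((C * cos (w.1.2 * sigma * X v) - D * sin (w.1.2 * sigma * X v))
   + trig l (y + sigma * X v))); last first.
  apply: eq_Rintegral => v _; rewrite /trig big_cons; congr (_ + _).
  have -> : w.1.2 * (y + sigma * X v) + w.2 = (w.1.2 * y + w.2) + w.1.2 * sigma * X v by ring.
  by rewrite cosD /C /D; ring.
have i1 : Q.-integrable setT (EFin \o (fun v => C * cos (w.1.2 * sigma * X v))).
  have := integrableZl measurableT C (mcos (w.1.2 * sigma)).
  exact: eq_integrable.
have i2 : Q.-integrable setT (EFin \o (fun v => D * sin (w.1.2 * sigma * X v))).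
  have := integrableZl measurableT D (msin (w.1.2 * sigma)).
  exact: eq_integrable.
have i12 : Q.-integrable setT (EFin \o (fun v =>
    C * cos (w.1.2 * sigma * X v) - D * sin (w.1.2 * sigma * X v))).
  have := integrableB measurableT i1 i2; exact: eq_integrable.
rewrite RintegralD//; last exact: integrable_trig_rv.
rewrite RintegralB// RintegralZl// RintegralZl// -ih.
have [-> ->] := stable_cos_sin (w.1.2 * sigma).
rewrite mulr0 subr0 dE !trigE big_cons; congr (_ + _).
by rewrite /C; ring.
Qed.

Lemma damping_bound (l : seq (R * R * R)) (A s y : R) : 0 <= s <= 1 ->
  (forall x, `|trig l x| <= A) -> `|trig (mult (damping s) l) y| <= A.
Proof.
move=> s01 lA; rewrite stable_smoothing//; apply: norm_Rintegral_le => //.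
apply: integrable_trig_rv; by apply: measurable_funD => //; exact: measurable_funM.
Qed.

End stable_law.

(** * The interpolation *)
Section interpolation.
Context {R : realType} (alpha : R) (m : {posnum R}).
Hypothesis alpha12 : 1 < alpha < 2.
Local Notation levy_cos := (levy_cos alpha m).
Local Notation levy_sin := (levy_sin alpha m).
Local Notation damping := (damping alpha m).
Local Notation generator l := (trig (mult levy_sin (quarter l))).

Let a1 : 1 < alpha. Proof. by case/andP: alpha12. Qed.
Let alpha0 : 0 < alpha. Proof. exact: lt_trans a1. Qed.

(** The function q_s(x) = E h'(s x + sigma(s) X) for h = trig l. *)
Definition drift (l : seq (R * R * R)) (s : R) : seq (R * R * R) :=
  dilate s (mult (damping s) (dtrig l)).

Lemma is_derive_damping (z s : R) : 0 < s ->
  is_derive s 1 (fun s => damping s z)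
    (damping s z * (levy_cos z * (alpha * s `^ (alpha - 1)))).
Proof.
move=> s0.
have h1 := is_deriveZ (levy_cos z) (is_derive1_powR alpha s0).
have h2 := is_deriveB h1 (is_derive_cst (levy_cos z) s (1 : R)).
have h3 := @is_derive1_comp _ expR _ s _ _ (is_derive_expR _) h2.
have E : (fun s => damping s z) = expR \o (levy_cos z \*: (@powR R ^~ alpha) - cst (levy_cos z)).
  apply/funext => t; rewrite /damping /=; congr expR.
  by rewrite -[RHS]/(levy_cos z * t `^ alpha - levy_cos z); ring.
rewrite E; apply: is_derive_eq.
rewrite subr0; congr (_ * _); exact: esym (congr1 (fun f : R -> R => f s) E).
Qed.

(** On each cosine the derivative of the dilation gives x q_s(x), and that of
the damping gives psi (z) alpha s^(alpha - 1), which is z [levy_sin] (z s) by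
[mul_levy_sin] and the homogeneity of psi. *)
Lemma is_derive_interpolant (l : seq (R * R * R)) (x s : R) : 0 < s ->
  is_derive s 1 (fun s => trig (mult (damping s) l) (s * x))
    (x * trig (drift l s) x - generator (drift l s) x).
Proof.
move=> s0.
have -> : x * trig (drift l s) x - generator (drift l s) x =
  \sum_(w <- l) (w.1.1 * (damping s w.1.2 * (levy_cos w.1.2 * (alpha * s `^ (alpha - 1))))
     * cos (w.1.2 * (s * x) + w.2)
   - w.1.1 * damping s w.1.2 * (w.1.2 * x) * sin (w.1.2 * (s * x) + w.2)).
  rewrite /drift trig_dilate -dtrig_mult trig_mult_quarter.
  rewrite trig_mult_quarter big_map !big_map.
  rewrite opprK mulrN mulr_sumr addrC -sumrB; apply: eq_bigr => w _ /=.
  have -> : sin (w.1.2 * s * x + (w.2 + pi / 2)) = cos (w.1.2 * (s * x) + w.2).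
    by rewrite addrA sinDpihalf mulrA.
  have hs : w.1.2 * levy_sin (w.1.2 * s) = levy_cos w.1.2 * (alpha * s `^ (alpha - 1)).
    apply: (@mulIf _ s); first by rewrite gt_eqF.
    rewrite mulrAC (mul_levy_sin m alpha12) (levy_cos_scale m alpha12 (w.1.2 * s)).
    rewrite normrM powRM// (gtr0_norm s0) (levy_cos_scale m alpha12 w.1.2).
    have -> : s `^ alpha = s `^ (alpha - 1) * s.
      rewrite -{3}(powRr1 (ltW s0)) -powRD ?subrK//.
      by apply/implyP => _; rewrite gt_eqF.
    by ring.
  by rewrite -hs; ring.
rewrite (_ : (fun s => trig (mult (damping s) l) (s * x)) =
  (fun s => \sum_(w <- l) w.1.1 * damping s w.1.2 * cos (w.1.2 * (s * x) + w.2))); last first.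
  by apply/funext => t; rewrite trigE.
elim: l => [|w l ih].
  rewrite big_nil; under eq_fun do rewrite big_nil.
  exact: is_derive_cst.
rewrite big_cons; under eq_fun do rewrite big_cons.
apply: is_deriveD.
have h1 := is_derive_damping w.1.2 s0.
have h2 : is_derive s 1 (fun s => w.1.2 * (s * x) + w.2) (w.1.2 * x).
  have := is_deriveD (is_deriveZ (w.1.2 * x) (is_derive_id s (1 : R)))
    (is_derive_cst w.2 s (1 : R)).
  rewrite addr0 /GRing.scale/= mulr1; congr (is_derive s 1 _ _).
  by apply/funext => t; rewrite -[LHS]/(w.1.2 * x * t + w.2); ring.
have h3 := @is_derive1_comp _ cos _ s _ _ (is_derive_cos _) h2.
have h4 := is_deriveZ w.1.1 (is_deriveM h1 h3).
rewrite (_ : (fun s => _) = w.1.1 \*: ((fun s => damping s w.1.2) *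
    (cos \o (fun s => w.1.2 * (s * x) + w.2)))); last first.
  by apply/funext => t; rewrite -[RHS]/(w.1.1 * (damping t w.1.2 * cos (w.1.2 * (t * x) + w.2))) [RHS]mulrA.
by apply: is_derive_eq; rewrite /GRing.scale/=; ring.
Qed.

End interpolation.

(** * Integrating along the interpolation *)
Section interpolation_bound.
Context {R : realType} (alpha : R) (m : {posnum R}).
Hypothesis alpha12 : 1 < alpha < 2.
Local Notation nu := (levy_measure alpha m).
Local Notation levy_cos := (levy_cos alpha m).
Local Notation levy_sin := (levy_sin alpha m).
Local Notation levyC := (levyC alpha m).
Local Notation damping := (damping alpha m).
Local Notation drift := (drift alpha m).
Local Notation generator l := (trig (mult levy_sin (quarter l))).

Let a1 : 1 < alpha. Proof. by case/andP: alpha12. Qed.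
Let alpha0 : 0 < alpha. Proof. exact: lt_trans a1. Qed.

Lemma levy_sin_bound (w : R) : `|levy_sin w| <= (1 + `|w|) * levyC.
Proof.
rewrite /levy_sin (le_trans (le_normr_Rintegral _ _))//.
  exact: integrable_levy_sin.
rewrite -RintegralZl//; last exact: integrable_weight.
apply: le_Rintegral => //.
- by apply: (@integrable_norm _ _ _ _ _ (fun u : R => u * sin (w * u)));
    exact: integrable_levy_sin.
- have := integrableZl measurableT (1 + `|w|) (integrable_weight m alpha12).
  exact: eq_integrable.
- by move=> u _; exact: sin_weight.
Qed.

Lemma damping_le (s z : R) : 0 <= s <= 2 -> damping s z <= expR (levy_cos z * 2 `^ alpha).
Proof.
move=> /andP[s0 s2]; rewrite ler_expR.
have h : s `^ alpha <= 2 `^ alpha.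
  by apply: ge0_ler_powR; rewrite ?nnegrE// ltW.
have l0 := levy_cos_ge0 alpha m z.
have := ler_wpM2l l0 h; lra.
Qed.

Lemma damping_sub (t z : R) : 0 <= t <= 1 ->
  `|damping t z - damping 0 z| <= levy_cos z * t.
Proof.
move=> /andP[t0 t1].
have l0 := levy_cos_ge0 alpha m z.
have ta : 0 <= t `^ alpha <= t.
  rewrite powR_ge0/=.
  have [->|t0'] := eqVneq t 0; first by rewrite powR0// gt_eqF.
  rewrite -[leRHS](powRr1 t0); apply: ger_powR; last exact: ltW.
  by rewrite lt_neqAle eq_sym t0' t0.
have /andP[ta0 ta1] := ta.
rewrite /damping powR0 ?gt_eqF// subr0 mulr1.
have h2 : levy_cos z * t `^ alpha <= levy_cos z * t by rewrite ler_wpM2l.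
have h3 : levy_cos z * t <= levy_cos z by rewrite ler_piMr.
have h4 : 0 <= levy_cos z * t `^ alpha by rewrite mulr_ge0.
have := @mean_value_le R expR expR (- levy_cos z) 0 1 (@is_derive_expR R) _
  (- levy_cos z) (- (levy_cos z * (1 - t `^ alpha))).
rewrite mul1r => H; rewrite (le_trans (H _ _ _))//.
- move=> x /andP[_ x0]; rewrite ger0_norm ?expR_ge0//.
  by rewrite -expR0 ler_expR.
- by rewrite lexx oppr_le0.
- by apply/andP; split; lra.
- by rewrite ger0_norm; lra.
Qed.

Lemma cos_lip (x y : R) : `|cos y - cos x| <= `|y - x|.
Proof.
rewrite -[leRHS]mul1r.
apply: (@mean_value_le R (@cos R) (fun x => - sin x) (Num.min x y) (Num.max x y)).
- by move=> z _; rewrite normrN sin_max.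
- by rewrite ge_min lexx le_max lexx.
- by rewrite ge_min lexx le_max lexx !orbT.
Qed.

Context d (T : measurableType d) (P : probability T R) (S : T -> R).
Hypothesis mS : measurable_fun setT S.
Hypothesis iS : P.-integrable setT (EFin \o S).

Let G l s := \int[P]_w trig (mult (damping s) l) (s * S w).

(** Differentiation under the expectation; the dominating function is affine in
|S|, so one moment of S is enough.  The interval reaches beyond 1 so that the
right end point of the interpolation is interior. *)
Lemma is_derive_interpolation l (s : R) : 0 < s < 2 ->
  is_derive s 1 (G l)
    (\int[P]_w (S w * trig (drift l s) (S w) - generator (drift l s) (S w))).
Proof.
move=> /andP[s0 s2].
pose e z := expR (levy_cos z * 2 `^ alpha).
pose M1 := \sum_(w <- l) `|w.1.1| * `|w.1.2| * e w.1.2.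
pose M2 := \sum_(w <- l) `|w.1.1| * `|w.1.2| * e w.1.2 * ((1 + 2 * `|w.1.2|) * levyC).
pose f s w := trig (mult (damping s) l) (s * S w).
pose df s w := S w * trig (drift l s) (S w) - generator (drift l s) (S w).
have fdf (t : R) w : 0 < t -> is_derive t 1 (f ^~ w) (df t w).
  by move=> t0; exact: is_derive_interpolant.
have Is : [set` `]0, 2[] s by rewrite /= in_itv/= s0.
have intf (t : R) : [set` `]0, 2[] t -> P.-integrable setT (EFin \o f t).
  move=> _; apply: integrable_bounded => [|w]; last exact: trig_le.
  by apply: (measurableT_comp (measurable_trig _)); exact: measurable_funM.
have derf (t : R) w : [set` `]0, 2[] t -> setT w -> derivable (f ^~ w) t 1.
  by rewrite /= in_itv/= => /andP[t0 _] _; have /@ex_derive := fdf t w t0.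
have M10 : 0 <= M1.
  by apply: sumr_ge0 => w _; rewrite !mulr_ge0// expR_ge0.
have M20 : 0 <= M2.
  apply: sumr_ge0 => w _; rewrite !mulr_ge0 ?expR_ge0 ?addr_ge0 ?mulr_ge0//.
  exact: levyC_ge0.
have G0 w : 0 <= M1 * `|S w| + M2 by rewrite addr_ge0// mulr_ge0.
have intG : P.-integrable setT (EFin \o (fun w => M1 * `|S w| + M2)).
  have := integrableD measurableT (integrableZl measurableT M1 (integrable_norm iS))
    (finite_measure_integrable_cst P M2 measurableT).
  exact: eq_integrable.
have Gub (t : R) w : [set` `]0, 2[] t -> setT w -> `|partial1of2 f t w| <= M1 * `|S w| + M2.
  rewrite /= in_itv/= => /andP[t0 t2] _.
  rewrite partial1of2E (@derive_val _ _ _ _ _ _ _ (fdf t w t0)).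
  have t02 : 0 <= t <= 2 by rewrite !ltW.
  rewrite (le_trans (ler_normB _ _))// lerD//.
    rewrite normrM mulrC ler_wpM2r// (le_trans (trig_le _ _))//.
    rewrite /drift !big_map; apply: ler_sum => v _ /=.
    rewrite !normrM ler_wpM2l ?mulr_ge0//.
    by rewrite ger0_norm ?expR_ge0// damping_le.
  rewrite (le_trans (trig_le _ _))// /drift !big_map; apply: ler_sum => v _ /=.
  rewrite !normrM; apply: ler_pM => //.
    rewrite ler_wpM2l ?mulr_ge0//.
    by rewrite ger0_norm ?expR_ge0// damping_le.
  rewrite (le_trans (levy_sin_bound _))// ler_wpM2r ?levyC_ge0//.
  rewrite lerD2l normrM (gtr0_norm t0) mulrC ler_wpM2r// ltW//.
have d1 := @derivable_under_integral R _ _ P f setT measurableT s 0 2 Is intf derf _ G0 intG Gub.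
have d2 := @differentiation_under_integral R _ _ P f setT measurableT s 0 2 Is intf derf _ G0 intG Gub.
apply: DeriveDef; first exact: d1.
rewrite -derive1E d2; apply: eq_Rintegral => w _.
by rewrite partial1of2E (@derive_val _ _ _ _ _ _ _ (fdf s w s0)).
Qed.

Variables (E1 E2 : R).
Hypotheses (E10 : 0 <= E1) (E20 : 0 <= E2).
Hypothesis stein : forall l A B, (forall x, `|trig l x| <= A) ->
  (forall x, `|trig (dtrig l) x| <= B) ->
  `|\int[P]_w (S w * trig l (S w) - generator l (S w))| <= A * E1 + B * E2.

Context d' (T' : measurableType d') (Q : probability T' R) (X : {RV Q >-> R}).
Hypothesis stableX : symmetric_stable alpha m Q X.

(** At s = 0 the power s^alpha is not differentiable from both sides, so the
left end point is reached by this Lipschitz estimate instead. *)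
Lemma interpolation_near l : exists2 K : R, 0 <= K & forall t, 0 < t <= 1 ->
  `|G l t - \int[Q]_w trig l (X w)| <= K * t.
Proof.
pose K1 := \sum_(w <- l) `|w.1.1| * levy_cos w.1.2.
pose K2 := \sum_(w <- l) `|w.1.1| * `|w.1.2|.
have K10 : 0 <= K1 by apply: sumr_ge0 => w _; rewrite mulr_ge0// levy_cos_ge0.
have K20 : 0 <= K2 by apply: sumr_ge0 => w _; rewrite mulr_ge0.
exists (K1 + K2 * \int[P]_w `|S w|).
  by rewrite addr_ge0// mulr_ge0//; apply: Rintegral_ge0.
move=> t /andP[t0 t1].
have t01 : 0 <= t <= 1 by rewrite ltW.
pose g0 := trig (mult (damping 0) l) 0.
have -> : \int[Q]_w trig l (X w) = g0.
  rewrite /g0 (stable_smoothing alpha12 stableX) ?lexx ?ler01//.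
  apply: eq_Rintegral => w _.
  by rewrite powR0 ?gt_eqF// subr0 powR1 mul1r add0r.
have iG : P.-integrable setT (EFin \o (fun w => trig (mult (damping t) l) (t * S w))).
  apply: integrable_bounded => [|w]; last exact: trig_le.
  by apply: (measurableT_comp (measurable_trig _)); exact: measurable_funM.
have ic : P.-integrable setT (EFin \o (fun w : T => g0)).
  exact: finite_measure_integrable_cst.
have -> : g0 = \int[P]_w g0.
  by rewrite Rintegral_cst// [X in fine X](_ : _ = 1%E) ?mulr1//; exact: probability_setT.
rewrite -RintegralB//.
have iS' : P.-integrable setT (EFin \o (fun w => K1 * t + K2 * t * `|S w|)).
  have := integrableD measurableT (finite_measure_integrable_cst P (K1 * t) measurableT)
    (integrableZl measurableT (K2 * t) (integrable_norm iS)).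
  exact: eq_integrable.
have -> : (K1 + K2 * \int[P]_w `|S w|) * t = \int[P]_w (K1 * t + K2 * t * `|S w|).
  rewrite RintegralD//; last 2 first.
  - exact: finite_measure_integrable_cst.
  - have := integrableZl measurableT (K2 * t) (integrable_norm iS).
    exact: eq_integrable.
  rewrite Rintegral_cst// [X in fine X](_ : _ = 1%E); last exact: probability_setT.
  rewrite RintegralZl//; last exact: integrable_norm.
  by rewrite /=; ring.
apply: norm_Rintegral_le_Rintegral => //.
  have := integrableB measurableT iG ic; exact: eq_integrable.
move=> w.
have term (z th : R) :
    `|damping t z * cos (z * (t * S w) + th) - damping 0 z * cos th| <=
    levy_cos z * t + `|z| * (t * `|S w|).
  set c := cos (z * (t * S w) + th).
  have -> : damping t z * c - damping 0 z * cos th =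
    (damping t z - damping 0 z) * c + damping 0 z * (c - cos th).
    by rewrite mulrBl mulrBr addrA subrK.
  rewrite (le_trans (ler_normD _ _))// lerD// normrM.
    by rewrite (le_trans _ (damping_sub z t01))// ler_piMr// cos_max.
  rewrite (@le_trans _ _ `|c - cos th|)//.
    rewrite ler_piMl// ger0_norm ?expR_ge0// -expR0 ler_expR oppr_le0.
    by rewrite powR0 ?gt_eqF// subr0 mulr1 levy_cos_ge0.
  by rewrite (le_trans (cos_lip _ _))// addrK !normrM (gtr0_norm t0).
have -> : trig (mult (damping t) l) (t * S w) - g0 = \sum_(v <- l) v.1.1 *
    (damping t v.1.2 * cos (v.1.2 * (t * S w) + v.2) - damping 0 v.1.2 * cos v.2).
  rewrite /g0 trigE trigE -sumrB; apply: eq_bigr => v _.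
  by rewrite mulr0 add0r mulrBr !mulrA.
have -> : K1 * t + K2 * t * `|S w| = \sum_(v <- l) `|v.1.1| *
    (levy_cos v.1.2 * t + `|v.1.2| * (t * `|S w|)).
  rewrite /K1 /K2 !mulr_suml -big_split/=; apply: eq_bigr => v _.
  by rewrite mulrDr !mulrA.
rewrite (le_trans (ler_norm_sum _ _ _))//; apply: ler_sum => v _.
by rewrite normrM ler_wpM2l.
Qed.

(** The derivative at s is at most A E1 + s B E2, because [drift] is bounded by A
and its derivative by s B; integrating over [0, 1] halves the second term.
The integration is done with the mean value theorem, by subtracting a
primitive of the bound. *)
Lemma interpolation_bound l A B :
  (forall x, `|trig (dtrig l) x| <= A) ->
  (forall x, `|trig (dtrig (dtrig l)) x| <= B) ->
  `|\int[P]_w trig l (S w) - \int[Q]_w trig l (X w)| <= A * E1 + B * E2 / 2.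
Proof.
move=> lA lB.
have A0 : 0 <= A by rewrite (le_trans _ (lA 0)).
have B0 : 0 <= B by rewrite (le_trans _ (lB 0)).
pose DG s := \int[P]_w (S w * trig (drift l s) (S w) - generator (drift l s) (S w)).
have dG (s : R) : 0 < s < 2 -> is_derive s 1 (G l) (DG s) by exact: is_derive_interpolation.
have DGle s : 0 < s <= 1 -> `|DG s| <= A * E1 + s * B * E2.
  move=> /andP[s0 s1]; have s01 : 0 <= s <= 1 by rewrite ltW.
  apply: stein => x.
    by rewrite trig_dilate (damping_bound alpha12 stableX).
  rewrite dtrig_dilate normrM (gtr0_norm s0) ler_wpM2l ?(ltW s0)// dtrig_mult.
  exact: (damping_bound alpha12 stableX).
have G1 : G l 1 = \int[P]_w trig l (S w).
  apply: eq_Rintegral => w _; rewrite mul1r trigE; apply: eq_bigr => v _.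
  by rewrite /damping powR1 subrr mulr0 oppr0 expR0 mulr1.
have main t : 0 < t < 1 -> `|G l 1 - G l t| <= A * E1 + B * E2 / 2.
  move=> /andP[t0 t1].
  have dlin (s c1 c2 : R) : is_derive s 1 (fun s : R => c1 * s + c2 * s ^+ 2) (c1 + c2 * (s + s)).
    have h := is_deriveD (is_deriveZ c1 (is_derive_id s (1 : R)))
      (is_deriveZ c2 (is_deriveM (is_derive_id s (1 : R)) (is_derive_id s (1 : R)))).
    rewrite (_ : (fun s : R => _) = c1 \*: (id : R -> R) + c2 \*: ((id : R -> R) * (id : R -> R))); last first.
      by apply/funext => u; rewrite -[RHS]/(c1 * u + c2 * (u * u)) expr2.
    by move: h => /is_derive_eq; apply; rewrite /GRing.scale/= !mulr1.
  have sub (c1 c2 : R) : exists2 s, t < s < 1 &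
      G l 1 - G l t - (c1 * (1 - t) + c2 * (1 - t ^+ 2)) = (DG s - (c1 + c2 * (s + s))) * (1 - t).
    pose Phi := G l - (fun s : R => c1 * s + c2 * s ^+ 2).
    have dPhi (s : R) : 0 < s < 2 -> is_derive s 1 Phi (DG s - (c1 + c2 * (s + s))).
      by move=> s02; exact: (is_deriveB (dG s s02) (dlin s c1 c2)).
    have dPhi' (s : R) : s \in `]t, 1[ -> is_derive s 1 Phi (DG s - (c1 + c2 * (s + s))).
      by rewrite in_itv/= => /andP[st s1]; apply: dPhi; apply/andP; split; lra.
    have cPhi : {within `[t, 1], continuous Phi}.
      apply: derivable_within_continuous => s; rewrite in_itv/= => /andP[st s1].
      have s02 : 0 < s < 2 by apply/andP; split; lra.
      by have /@ex_derive := dPhi s s02.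
    have [s + E] := MVT t1 dPhi' cPhi; rewrite in_itv/= => st.
    exists s => //; rewrite -E.
    rewrite -[RHS]/(G l 1 - (c1 * 1 + c2 * 1 ^+ 2) - (G l t - (c1 * t + c2 * t ^+ 2))).
    by ring.
  have AE : 0 <= A * E1 by rewrite mulr_ge0.
  have BE : 0 <= B * E2 by rewrite mulr_ge0.
  have t2 : 0 <= t ^+ 2 by rewrite sqr_ge0.
  have Mt : A * E1 * (1 - t) + B * E2 / 2 * (1 - t ^+ 2) <= A * E1 + B * E2 / 2 by nra.
  apply: le_trans Mt.
  rewrite ler_norml; apply/andP; split.
    have [s /andP[st s1] E] := sub (- (A * E1)) (- (B * E2 / 2)).
    have s01 : 0 < s <= 1 by apply/andP; split; lra.
    have := DGle s s01; rewrite ler_norml => /andP[h _].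
    have : 0 <= (DG s - (- (A * E1) + - (B * E2 / 2) * (s + s))) * (1 - t).
      by rewrite mulr_ge0//; lra.
    by rewrite -E; lra.
  have [s /andP[st s1] E] := sub (A * E1) (B * E2 / 2).
  have s01 : 0 < s <= 1 by apply/andP; split; lra.
  have := DGle s s01; rewrite ler_norml => /andP[_ h].
  have : (DG s - (A * E1 + B * E2 / 2 * (s + s))) * (1 - t) <= 0.
    by rewrite mulr_le0_ge0//; lra.
  by rewrite -E; lra.
have [K K0 Kt] := interpolation_near l.
rewrite -G1; apply/ler_addgt0Pr => e e0.
have K1 : 0 < K + 1 by lra.
pose t := Num.min 2^-1 (e / (K + 1)).
have t0 : 0 < t by rewrite lt_min (divr_gt0 e0 K1) andbT invr_gt0 ltr0n.
have t1 : t < 1 by rewrite gt_min; apply/orP; left; lra.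
have te : K * t <= e.
  rewrite (@le_trans _ _ (K * (e / (K + 1))))//; first by rewrite ler_wpM2l// ge_min lexx orbT.
  by rewrite mulrCA ler_piMr ?(ltW e0)// ler_pdivrMr// mul1r; lra.
have -> : G l 1 - \int[Q]_w trig l (X w) = (G l 1 - G l t) + (G l t - \int[Q]_w trig l (X w)) by ring.
rewrite (le_trans (ler_normD _ _))// lerD//; first by apply: main; rewrite t0.
by rewrite (le_trans (Kt t _))// t0 ltW.
Qed.

End interpolation_bound.

(** * From sums of cosines to all test functions *)
Section test_functions.
Context {R : realType}.

Lemma H2_continuous (h : R -> R) : H2 h -> continuous h.
Proof.
move=> /H2_derive[dh _ _ _] x.
apply: differentiable_continuous; apply/derivable1_diffP.
by have /@ex_derive := dh x.
Qed.

Lemma H2_le1 (h : R -> R) x : H2 h -> `|h x| <= 1.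
Proof. by move=> /H2_derive[_ _ _ hle]; exact: (hle 0%N). Qed.

Context d (T : measurableType d) (P : probability T R) (W : T -> R).
Hypothesis mW : measurable_fun setT W.

Lemma integrable_H2 (h : R -> R) : H2 h -> P.-integrable setT (EFin \o (h \o W)).
Proof.
move=> Hh; apply: (@integrable_bounded _ _ _ P _ 1) => [|w]; last exact: H2_le1.
by apply: measurableT_comp => //; exact: continuous_measurable_fun (H2_continuous Hh).
Qed.

Lemma cvg_trig_expectation (h : R -> R) (l : nat -> seq (R * R * R)) :
  (forall k x, `|trig (l k) x| <= 2) ->
  (forall k x, `|x| <= k%:R -> `|trig (l k) x - h x| <= k.+1%:R^-1) ->
  H2 h ->
  (\int[P]_w trig (l k) (W w)) @[k --> \oo] --> \int[P]_w h (W w).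
Proof.
move=> l2 lh Hh; apply: fine_cvg; rewrite fineK; last exact: integrable_fin_num (integrable_H2 Hh).
apply: (@dominated_cvg _ _ _ P setT measurableT
  (fun k w => (trig (l k) (W w))%:E) _ (EFin \o cst 2)) => //=.
- move=> k; apply/measurable_EFinP.
  by apply: measurableT_comp => //; exact: measurable_trig.
- move=> w _; apply: cvg_EFin; first exact: nearW.
  apply/cvgrPdist_le => e e0; near=> k.
  rewrite /= distrC (le_trans (lh k _ _))//.
    by near: k; exact: nbhs_infty_ger.
  rewrite invf_ple ?posrE// (@le_trans _ _ k%:R)//; last by rewrite ler_nat.
  by near: k; exact: nbhs_infty_ger.
- exact: finite_measure_integrable_cst.
- by move=> k w _; rewrite lee_fin.
Unshelve. all: by end_near. Qed.

End test_functions.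

(** Apply the hypothesis to approximations of h whose derivatives are bounded by
1 + 1 / (k + 1) and which converge to h pointwise, then let k grow. *)
Lemma H2_comparison (R : realType) d (T : measurableType d) (P : probability T R)
    d' (T' : measurableType d') (Q : probability T' R) (S : T -> R) (X : T' -> R)
    (M1 M2 : R) :
  measurable_fun setT S -> measurable_fun setT X ->
  (forall l (A B : R), (forall x, `|trig (dtrig l) x| <= A) ->
     (forall x, `|trig (dtrig (dtrig l)) x| <= B) ->
     `|\int[P]_w trig l (S w) - \int[Q]_w trig l (X w)| <= A * M1 + B * M2) ->
  forall h, H2 h -> `|\int[P]_w h (S w) - \int[Q]_w h (X w)| <= M1 + M2.
Proof.
move=> mS mX H h Hh.
have ex (k : nat) : exists l : seq (R * R * R), [/\ forall x, `|trig l x| <= 2,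
    forall x, `|trig (dtrig l) x| <= 1 + k.+1%:R^-1,
    forall x, `|trig (dtrig (dtrig l)) x| <= 1 + k.+1%:R^-1 &
    forall x, `|x| <= k%:R -> `|trig l x - h x| <= k.+1%:R^-1].
  apply: trig_approx_H2 => //.
  by rewrite invr_gt0 ltr0n/= invf_le1 ?ler1n.
have [l /all_and4[l2 l1 ll lh]] := choice ex.
have c1 := @cvg_trig_expectation R _ T P S mS h l l2 lh Hh.
have c2 := @cvg_trig_expectation R _ T' Q X mX h l l2 lh Hh.
have c3 : `|\int[P]_w trig (l k) (S w) - \int[Q]_w trig (l k) (X w)| @[k --> \oo] -->
    `|\int[P]_w h (S w) - \int[Q]_w h (X w)|.
  exact: cvg_norm (cvgB c1 c2).
have c4 : ((1 + k.+1%:R^-1) * (M1 + M2)) @[k --> \oo] --> (1 + 0) * (M1 + M2).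
  apply: cvgM; last exact: cvg_cst.
  by apply: cvgD; [exact: cvg_cst|exact: cvg_harmonic].
have E : M1 + M2 = (1 + 0) * (M1 + M2) by rewrite addr0 mul1r.
rewrite E.
apply: ler_cvg_to c3 c4 _; apply: nearW => k /=.
by rewrite (le_trans (H _ _ _ (l1 k) (ll k)))// mulrDr.
Qed.

Theorem theorem3p19 (R : realType) (alpha : R) (m : {posnum R})
    (alpha12 : 1 < alpha < 2) :
  exists C : R, 0 < C /\
  forall (d d' : measure_display)
    (T : measurableType d) (P : probability T R)
    (T' : measurableType d') (Q : probability T' R)
    (X : {RV Q >-> R}) (n : nat) (Y : 'I_n -> {RV P >-> R}),
    symmetric_stable alpha m Q X ->
    (0 < n)%N ->
    mutually_independent P Y ->
    identically_distributed P Y ->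
    (forall i, P.-integrable setT (EFin \o Y i)) ->
    (forall i, 'E_P[Y i] = 0)%E ->
    let Z := fun (i : 'I_n) (w : T) => n%:R `^ (- alpha^-1) * Y i w in
    let S := fun w : T => \sum_(i < n) Z i w in
    forall N : R, 0 < N ->
    let Rem :=
      (2%:E * (\int[levy_measure alpha m]_(u in [set u : R | (N < `|u|)%R]) `|u|%:E
               + \sum_(i < n) 'E_P[fun w => (`|Z i w| * (N < `|Z i w|)%R%:R)%R])
       + (C / n%:R)%:E * \sum_(i < n) 'E_P[fun w => (`|Z i w| `^ (2 - alpha))%R])%E in
    (dW2 P S Q X <=
      (2^-1)%:E * \sum_(i < n) \int[lebesgue_measure]_(t in `[(- N)%R, N])
         `| K_nu alpha m t N * (n%:R^-1)%:E - K_rv P (Z i) t N |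
      + Rem)%E.
Proof.
have C0 := levyC_ge0 alpha m.
(* [levyC] is nonnegative, and adding 1 makes it positive *)
exists (levyC alpha m + 1); split; first lra.
move=> d d' T P T' Q X n Y stableX n0 indepY _ Yi EY Z S N N0.
have nR0 : 0 < n%:R :> R by rewrite ltr0n.
have Y0 i : \int[P]_w Y i w = 0.
  by have := EY i; rewrite unlock /Rintegral => ->.
set a := n%:R `^ (- alpha^-1) in Z S *.
have mZ i : measurable_fun setT (Z i) := measurable_summand Y a i.
have iZ i : P.-integrable setT (EFin \o Z i) := integrable_summand a Yi i.
have mS : measurable_fun setT S := measurable_total Y a.
have iS : P.-integrable setT (EFin \o S) := integrable_total a Yi.
have mX : measurable_fun setT X by exact: measurable_funP.
pose r i := \int[P]_w (`|Z i w| * (N < `|Z i w|)%R%:R).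
pose rho i := \int[P]_w (`|Z i w| `^ (2 - alpha)).
pose D i := fine (kernel_dist alpha m P (Z i) n%:R^-1 N).
have r0 i : 0 <= r i by apply: Rintegral_ge0 => w _; rewrite mulr_ge0.
have rho0 i : 0 <= rho i by apply: Rintegral_ge0 => w _; rewrite powR_ge0.
have D0 i : 0 <= D i by rewrite fine_ge0// kernel_dist_ge0.
have tau0 : 0 <= levy_tail alpha m N by apply: Rintegral_ge0 => u _; rewrite mulr_ge0.
pose E1 := 2 * (levy_tail alpha m N + \sum_(i < n) r i).
pose E2 := \sum_(i < n) D i + 2 * levyC alpha m / n%:R * \sum_(i < n) rho i.
have E10 : 0 <= E1 by rewrite mulr_ge0// addr_ge0// sumr_ge0.
have E20 : 0 <= E2.
  by rewrite addr_ge0 ?sumr_ge0// mulr_ge0 ?sumr_ge0// divr_ge0 ?mulr_ge0// ltW.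
have stein l A B : (forall x, `|trig l x| <= A) -> (forall x, `|trig (dtrig l) x| <= B) ->
    `|\int[P]_w (S w * trig l (S w) - trig (mult (levy_sin alpha m) (quarter l)) (S w))| <=
    A * E1 + B * E2.
  move=> lA lB; rewrite (le_trans (stein_sum m alpha12 a n0 indepY Yi Y0 N0 lA lB))//.
  by rewrite /E1 mulrCA mulrA lexx.
have bound h : H2 h -> `|\int[P]_w h (S w) - \int[Q]_w h (X w)| <= E1 + E2 / 2.
  apply: (@H2_comparison R _ _ P _ _ Q S X E1 (E2 / 2) mS mX) => l A B lA lB.
  rewrite mulrA.
  exact: (interpolation_bound alpha12 mS iS E10 E20 stein stableX lA lB).
have E_r i : ('E_P[fun w => (`|Z i w| * (N < `|Z i w|)%R%:R)%R] = (r i)%:E)%E.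
  rewrite unlock /r /Rintegral fineK//.
  exact: integrable_fin_num (integrable_tail_rv N (iZ i)).
have E_rho i : ('E_P[fun w => (`|Z i w| `^ (2 - alpha))%R] = (rho i)%:E)%E.
  rewrite unlock /rho /Rintegral fineK//; apply: integrable_fin_num => //.
  by apply: integrable_norm_powR => //; case/andP: alpha12 => *; apply/andP; split; lra.
have E_tau : (\int[levy_measure alpha m]_(u in [set u : R | (N < `|u|)%R]) `|u|%:E =
    (levy_tail alpha m N)%:E)%E.
  rewrite /levy_tail /Rintegral fineK; last first.
    exact: integrable_fin_num (integrable_levy_tail m alpha12 N0).
  rewrite [LHS]integral_mkcond; apply: eq_integral => u _; rewrite patchE.
  rewrite (_ : (u \in _) = (N < `|u|)); last by apply/idP/idP; rewrite inE.
  by case: ifPn => _; rewrite ?mulr1 ?mulr0.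
apply: (@le_trans _ _ (E1 + E2 / 2)%:E).
  apply: ub_ereal_sup => _ [h Hh <-].
  rewrite unlock.
  have i1 := integrable_fin_num measurableT (integrable_H2 P mS Hh).
  have i2 := integrable_fin_num measurableT (integrable_H2 Q mX Hh).
  rewrite -(fineK i1) -(fineK i2) -EFinB abse_EFin lee_fin.
  exact: bound.
cbv zeta; rewrite E_tau.
under [X in (_ <= _ + (2%:E * (_ + X) + _))%E]eq_bigr do rewrite E_r.
under [X in (_ <= _ + (_ + _ * X))%E]eq_bigr do rewrite E_rho.
rewrite (eq_bigr (fun i => (D i)%:E)); last first.
  by move=> i _; rewrite /D fineK//; exact: kernel_dist_fin_num.
rewrite !sumEFin.
change ((E1 + E2 / 2)%:E <= (2^-1 * \sum_(i < n) D i +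
  (2 * (levy_tail alpha m N + \sum_(i < n) r i) +
   (levyC alpha m + 1) / n%:R * \sum_(i < n) rho i))%:E)%E.
rewrite lee_fin /E1 /E2.
have h : 0 <= n%:R^-1 * \sum_(i < n) rho i by rewrite mulr_ge0 ?sumr_ge0// invr_ge0 ltW.
have -> : (levyC alpha m + 1) / n%:R * \sum_(i < n) rho i =
  levyC alpha m / n%:R * \sum_(i < n) rho i + n%:R^-1 * \sum_(i < n) rho i by ring.
lra.
Qed.
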